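(* Let $P$ be a closed bounded convex polyhedron in $\mathbb{R}^d$ with distinct vertices $a_1,\dots,a_n$, $n\ge2$, such that $a_1=0$ and $\mathrm{Span}(a_2,\dots,a_n)=\mathbb{R}^d$. Then on $P$ there exist Lipschitz continuous nonnegative functions $p_1(x),\dots,p_n(x)$ which are infinitely differentiable in $P^o$ and such that: (i) $p_k>0$ in $P^o$ for every $k$; (ii) for all $x\in P$, $$\sum_{k=1}^n p_k(x)=1,\qquad x=\sum_{k=1}^n p_k(x)a_k;$$ (iii) for every $k$, every $\xi\in\mathbb{R}^d$ and every $x\in P^o$, $$\frac{|p_{k(\xi)}(x)|}{p_k^{1/2}(x)}\le N\max_{\Gamma\in\Phi}\frac{|(n_\Gamma,\xi)|}{d_\Gamma^{1/2}(x)},$$ where $N$ is a finite constant depending only on $P$.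
   Context: $P^o$ is the interior of $P$. $\Phi$ is the set of $(d-1)$-dimensional faces of $P$; for $\Gamma\in\Phi$ and $x\in P^o$, $d_\Gamma(x)$ is the distance from $x$ to $\Gamma$, and $n_\Gamma$ is a unit normal vector to $\Gamma$. $(\cdot,\cdot)$ is the Euclidean inner product. For a function $w$ and a vector $\xi$, $w_{(\xi)}=(\xi,\nabla w)$; thus $p_{k(\xi)}(x)=(\xi,\nabla p_k(x))$. *)

(* Defs.v *)
From HB Require Import structures.
From mathcomp Require Import all_boot all_order all_algebra.
From mathcomp Require Import all_classical all_reals all_analysis.

Set Implicit Arguments.
Unset Strict Implicit.
Unset Printing Implicit Defensive.

Import Order.TTheory GRing.Theory Num.Theory.
Import numFieldNormedType.Exports.

Local Open Scope classical_set_scope.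
Local Open Scope ring_scope.

(* R^d is 'rV[R]_d. Its library norm is the sup norm, which induces the usual
   topology, bounded sets and Lipschitz functions; lengths and distances are
   taken in the Euclidean norm [enorm]. *)

Definition dot (R : realType) (d : nat) (u v : 'rV[R]_d) : R :=
  \sum_(i < d) u ord0 i * v ord0 i.

Definition enorm (R : realType) (d : nat) (u : 'rV[R]_d) : R :=
  Num.sqrt (dot u u).

Definition edist_set (R : realType) (d : nat) (x : 'rV[R]_d)
    (F : set 'rV[R]_d) : R :=
  inf [set enorm (x - y) | y in F].

(* Closedness and convexity are automatic; boundedness is a separate
   hypothesis. *)
Definition polyhedron (R : realType) (d : nat) (P : set 'rV[R]_d) : Prop :=
  exists (m : nat) (c : 'I_m -> 'rV[R]_d) (b : 'I_m -> R),
    P = [set x | forall i, dot (c i) x <= b i].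

(* c = 0 gives P itself and possibly the empty set as (improper) faces; the
   dimension conditions below exclude them where needed. *)
Definition is_face (R : realType) (d : nat) (P F : set 'rV[R]_d) : Prop :=
  exists (c : 'rV[R]_d) (b : R),
    (forall y, P y -> dot c y <= b) /\ F = [set y | P y /\ dot c y = b].

(* V is the linear span of F - F, i.e. the direction of the affine hull of F. *)
Definition is_direction (R : realType) (d : nat) (F : set 'rV[R]_d)
    (V : {vspace 'rV[R]_d}) : Prop :=
  forall W : {vspace 'rV[R]_d},
    (V <= W)%VS <-> (forall y z, F y -> F z -> y - z \in W).

Definition has_dim (R : realType) (d : nat) (F : set 'rV[R]_d) (k : nat) :
    Prop :=
  F !=set0 /\ exists2 V : {vspace 'rV[R]_d}, is_direction F V & \dim V = k.

Definition vertices (R : realType) (d : nat) (P : set 'rV[R]_d) :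
    set 'rV[R]_d :=
  [set v | is_face P [set v]].

Definition facets (R : realType) (d : nat) (P : set 'rV[R]_d) :
    set (set 'rV[R]_d) :=
  [set F | is_face P F /\ exists2 k : nat, k.+1 = d & has_dim F k].

Definition unit_normal (R : realType) (d : nat) (F : set 'rV[R]_d)
    (v : 'rV[R]_d) : Prop :=
  enorm v = 1 /\ forall y z, F y -> F z -> dot v (y - z) = 0.

Definition partial (R : realType) (d : nat) (i : 'I_d) (f : 'rV[R]_d -> R) :
    'rV[R]_d -> R :=
  fun x => 'D_(delta_mx ord0 i) f x.

Definition gradient (R : realType) (d : nat) (f : 'rV[R]_d -> R)
    (x : 'rV[R]_d) : 'rV[R]_d :=
  \row_(i < d) partial i f x.

(* Meant for open U: there, all iterated partial derivatives being
   differentiable is the same as their existing and being continuous. *)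
Definition smooth_on (R : realType) (d : nat) (U : set 'rV[R]_d)
    (f : 'rV[R]_d -> R) : Prop :=
  forall (s : seq 'I_d) (x : 'rV[R]_d), U x ->
    differentiable (foldr (@partial R d) f s) x.

(* P has finitely many facets, so this supremum is a maximum. *)
Definition max_facets (R : realType) (d : nat) (P : set 'rV[R]_d)
    (g : set 'rV[R]_d -> R) : R :=
  sup [set g F | F in facets P].

(* Main.v *)
Require Import Defs.
From HB Require Import structures.
From mathcomp Require Import all_boot all_order all_algebra.
From mathcomp Require Import all_classical all_reals all_analysis.
From mathcomp Require Import ring lra.

Import Order.TTheory GRing.Theory Num.Theory.
Import numFieldNormedType.Exports.

Local Open Scope classical_set_scope.
Local Open Scope ring_scope.

(** The functions [p k] are the analytic centre coordinates: for [x] in the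
    interior of [P], the vector [p x] maximises the product of the [p_k] among
    all ways of writing [x] as a convex combination of the vertices.  Let [B]
    be the matrix whose rows are the vertices extended by a coordinate 1, so
    that the constraint reads [p B = (x, 1)].  The maximiser is positive and is
    characterised by [sum_k z_k / p_k = 0] for every [z] with [z B = 0]
    ([critical]).

    Smoothness and Lipschitz continuity come from one identity.  If [p] and
    [p'] are critical over [x] and [x'], then [p' - p] is orthogonal to the
    kernel of [B] for the weights [1 / (p_k p'_k)]; hence
    [p' - p = (x' - x, 0) L], where [L] is the least squares inverse of [B] for
    these weights.  Such inverses are bounded uniformly in the weights
    ([weighted_orth_bound]): the entries of a weighted orthogonal [q] have signs
    that no nonzero kernel vector shares, and there are finitely many sign
    patterns.  So [p] is Lipschitz in the interior, and extends to [P].  Since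
    [L] is a rational function of [p] and [p'], the identity also gives the
    differentiability of [p], with partial derivatives rational in [p]; by
    induction [p] is smooth.

    For the gradient bound, the derivative [q] of [p] in the direction [v]
    minimises [sum_k q_k^2 / p_k^2] among the [q] with [q B = (v, 0)].  Let [S]
    be a set of vertices on which [p >= e], and let [v] be parallel to all facets
    that contain [S].  Moving from the centroid of [S] along [v] and along [-v]
    stays in [P] for a while; this produces a competitor, and criticality of
    [p] bounds its entries by a multiple of [p_j |v| / e]
    ([facial_preimage]).  Together with the uniform bound [|q_k| <= C |v|] this
    gives [|q_k| <= C |v| sqrt (p_k / e)] ([bary_diff_facial]).

    A general direction [xi] is split along a chain of sets of vertices: [S]
    grows by one vertex at a time, in the order of decreasing [p].  The distance
    from [xi] to the directions parallel to all facets containing [S] is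
    controlled by the components of [xi] along the normals of these facets,
    hence by a multiple of [M sqrt (sum_(k not in S) p_k)].  Here [M] is the
    maximum on the right of the bound, and the distance from [x] to a facet is
    at most a multiple of the total weight of the vertices off that facet
    ([constraint_face_edist]).  So the piece added with the vertex [j] has size
    at most a multiple of [M sqrt p_j], and contributes at most a multiple of
    [M sqrt p_k] to [q_k] ([bary_diff_bound]).

    Two facts on polyhedra link this to the statement: a bounded polyhedron
    is the convex hull of its vertices ([hrep_hull]), and since [P] has interior
    points, every inequality in a description of [P] by a minimal number of
    inequalities defines a facet ([constraint_face_facet]). *)

Set Implicit Arguments.
Unset Strict Implicit.

(** * Row vectors and uniform constants *)

Lemma ler_coord_norm (R : realType) n (u : 'rV[R]_n) i : `|u ord0 i| <= `|u|.
Proof.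
by rewrite [leRHS]/Num.Def.normr /= mx_normrE; apply/bigmax_geP; right => /=; exists (ord0, i).
Qed.

Lemma rV_norm_le (R : realType) n (u : 'rV[R]_n) (c : R) :
  0 <= c -> (forall i, `|u ord0 i| <= c) -> `|u| <= c.
Proof.
move=> c0 uc; rewrite [leLHS]/Num.Def.normr /= mx_normrE (bigmax_le _ c0)//= => -[i j] _.
by rewrite ord1 /=.
Qed.

Lemma mulmx_bounded (R : realType) n m (A : 'M[R]_(n, m)) :
  exists2 C : R, 0 <= C & forall u : 'rV_n, `|u *m A| <= C * `|u|.
Proof.
exists (\sum_j \sum_i `|A i j|); first by apply: sumr_ge0 => j _; apply: sumr_ge0.
move=> u; apply: rV_norm_le => [|j].
  by apply: mulr_ge0 => //; apply: sumr_ge0 => j _; apply: sumr_ge0.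
rewrite mxE (bigD1 j) //= mulrDl.
apply: (@le_trans _ _ ((\sum_i `|A i j|) * `|u|)).
  rewrite mulr_suml; apply: (le_trans (ler_norm_sum _ _ _)).
  by apply: ler_sum => i _; rewrite normrM mulrC ler_wpM2l // ler_coord_norm.
rewrite lerDl; apply: mulr_ge0 => //.
by apply: sumr_ge0 => k _; apply: sumr_ge0.
Qed.

(** Constants are found separately for each of finitely many combinatorial
    types (sign patterns, sets of vertices, constraints); this makes them
    uniform. *)
Lemma finite_uniform_bound (R : realType) (T : finType) (Q : T -> R -> Prop) :
  (forall t c c', c <= c' -> Q t c -> Q t c') ->
  (forall t, exists c, Q t c) ->
  exists2 c : R, 0 <= c & forall t, Q t c.
Proof.
move=> Qmono /choice[f Qf].
exists (\sum_t `|f t|); first exact: sumr_ge0.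
move=> t; apply: Qmono (Qf t); apply: (le_trans (ler_norm _)).
by rewrite (bigD1 t) //= lerDl sumr_ge0.
Qed.

Definition positive_row (R : realType) n (D : 'rV[R]_n) : Prop :=
  forall k, 0 < D ord0 k.

(** Orthogonality to the left kernel of [B] for the scalar product with weights
    [1 / D_k]: the optimality condition for minimising [sum_k q_k^2 / D_k] at a
    fixed value of [q *m B]. *)
Definition weighted_orth (R : realType) n m (B : 'M[R]_(n, m))
    (D q : 'rV[R]_n) : Prop :=
  forall z : 'rV_n, z *m B = 0 ->
    \sum_k q ord0 k * z ord0 k / D ord0 k = 0.

Definition sign_cone (R : realType) n (Z N : {set 'I_n}) : set 'rV[R]_n :=
  [set q | forall k, [/\ k \in Z -> q ord0 k = 0, k \in N -> q ord0 k <= 0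
                       & k \notin N -> 0 <= q ord0 k]].

Lemma sign_coneZ (R : realType) n (Z N : {set 'I_n}) (c : R) (q : 'rV[R]_n) :
  0 <= c -> sign_cone Z N q -> sign_cone Z N (c *: q).
Proof.
move=> c0 qZN k; have [q1 q2 q3] := qZN k; rewrite !mxE; split=> [kZ|kN|kN].
- by rewrite q1 // mulr0.
- by rewrite mulr_ge0_le0 // q2.
- by rewrite mulr_ge0 // q3.
Qed.

Lemma mulmx_continuous (R : realType) n m (B : 'M[R]_(n, m)) :
  continuous (fun q : 'rV[R]_n => q *m B).
Proof.
have [C C0 BC] := mulmx_bounded B.
move=> q; apply/(@cvgrPdist_le _ _ _ (nbhs q) (nbhs_filter q)) => e e0; near=> y.
rewrite -mulmxBl; apply: (le_trans (BC _)).
apply: (@le_trans _ _ ((C + 1) * `|q - y|)); first by rewrite ler_wpM2r // lerDl.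
rewrite -ler_pdivlMl ?ltr_wpDl //.
near: y; have /cvgrPdist_le qq : (y @[y --> q]) --> q by exact: cvg_id.
by apply: qq; rewrite mulr_gt0 // invr_gt0 ltr_wpDl.
Unshelve. all: by end_near. Qed.

Lemma sign_cone_closed (R : realType) n (Z N : {set 'I_n}) :
  closed (@sign_cone R n Z N).
Proof.
have cc k : continuous (fun q : 'rV[R]_n => q ord0 k) by exact: coord_continuous.
have -> : @sign_cone R n Z N = \bigcap_k (
   (fun q : 'rV[R]_n => q ord0 k) @^-1`
     [set x | [/\ k \in Z -> x = 0, k \in N -> x <= 0 & k \notin N -> 0 <= x]]).
  by apply/seteqP; split=> q /= H k; [move=> _; exact: H | exact: (H k Logic.I)].
apply: closed_bigI => k _; apply: closed_comp; first by move=> q _; exact: cc.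
have -> : [set x : R | [/\ k \in Z -> x = 0, k \in N -> x <= 0 & k \notin N -> 0 <= x]]
  = [set x | k \in Z -> x = 0] `&` [set x | k \in N -> x <= 0] `&` [set x | k \notin N -> 0 <= x].
  apply/seteqP; split=> x /=; first by case=> x1 x2 x3; split; first split.
  by case=> [[x1 x2] x3]; split.
apply: closedI; first apply: closedI.
- case: (k \in Z); last by rewrite [X in closed X](_ : _ = setT); [exact: closedT | apply/seteqP; split].
  rewrite [X in closed X](_ : _ = [set 0]); first exact: closed_eq.
  by apply/seteqP; split => x /=; [exact | move=> ->].
- case: (k \in N); last by rewrite [X in closed X](_ : _ = setT); [exact: closedT | apply/seteqP; split].
  rewrite [X in closed X](_ : _ = [set x | x <= 0]); first exact: closed_le.
  by apply/seteqP; split => x /=; [exact | move=> ->].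
- case: (k \notin N); last by rewrite [X in closed X](_ : _ = setT); [exact: closedT | apply/seteqP; split].
  rewrite [X in closed X](_ : _ = [set x | 0 <= x]); first exact: closed_ge.
  by apply/seteqP; split => x /=; [exact | move=> ->].
Qed.

(** On the unit sphere of the cone, which is compact, [q *m B] does not vanish;
    its least norm there gives the constant. *)
Lemma sign_cone_bound (R : realType) n m (B : 'M[R]_(n, m)) (Z N : {set 'I_n}) :
  exists C : R, (forall z, sign_cone Z N z -> z *m B = 0 -> z = 0) ->
    forall q, sign_cone Z N q -> `|q| <= C * `|q *m B|.
Proof.
have [tr|ntr] := pselect (forall z, sign_cone Z N z -> z *m B = 0 -> z = 0);
  last by exists 0 => /ntr.
pose S := @sign_cone R n Z N `&` [set q | `|q| = 1].
have normS q : sign_cone Z N q -> q != 0 -> S (`|q|^-1 *: q).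
  move=> qK q0; split; first by apply: sign_coneZ => //; rewrite invr_ge0.
  by rewrite /= normrZ normfV normr_id mulVf // normr_eq0.
have [[q0 Sq0]|S0] := pselect (S !=set0); last first.
  exists 0 => _ q qK; rewrite mul0r.
  have [->|qn0] := eqVneq q 0; first by rewrite normr0.
  by exfalso; apply: S0; exists (`|q|^-1 *: q); exact: normS.
have cS : compact S.
  apply: bounded_closed_compact.
    by exists 1; split => // M M1 q [_ /= ->]; exact: ltW.
  apply: closedI; first exact: sign_cone_closed.
  apply: (@closed_comp _ _ (fun q : 'rV[R]_n => `|q|) [set 1]); last exact: closed_eq.
  by move=> q _; exact: norm_continuous.
have cf : {within S, continuous (fun q : 'rV[R]_n => `|q *m B|)}.
  apply: continuous_subspaceT => q.
  apply: (@continuous_comp _ _ _ (fun q : 'rV[R]_n => q *m B) (fun y => `|y|)).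
    exact: mulmx_continuous.
  exact: norm_continuous.
have [q1 + minq] := EVT_min_rV (ex_intro _ q0 Sq0) cS cf.
rewrite inE => -[q1K /= q11].
have fpos : 0 < `|q1 *m B|.
  rewrite normr_gt0; apply/eqP => /tr -/(_ q1K) q10.
  by move: q11; rewrite q10 normr0 => /eqP; rewrite eq_sym oner_eq0.
exists (`|q1 *m B|^-1) => _ q qK.
have [->|qn0] := eqVneq q 0; first by rewrite normr0 mulr_ge0 // invr_ge0.
have := minq (`|q|^-1 *: q); rewrite inE => /(_ (normS _ qK qn0)).
rewrite -scalemxAl normrZ normfV normr_id ler_pdivlMl ?normr_gt0 //.
by rewrite ler_pdivlMl // mulrC.
Qed.

(** The constant does not depend on the weights.  Let [q] be orthogonal to the
    kernel and let [z] be a kernel vector with the signs of [q].  All terms of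
    [sum_k q_k z_k / D_k = 0] are nonnegative, so [z = 0].  Hence the bound for
    the sign cone of [q] applies, and it does not mention [D]. *)
Lemma weighted_orth_bound (R : realType) n m (B : 'M[R]_(n, m)) :
  exists2 C : R, 0 <= C & forall D q : 'rV[R]_n, positive_row D -> weighted_orth B D q ->
    `|q| <= C * `|q *m B|.
Proof.
pose Q (ZN : {set 'I_n} * {set 'I_n}) (C : R) :=
  (forall z, sign_cone ZN.1 ZN.2 z -> z *m B = 0 -> z = 0) ->
    forall q, sign_cone ZN.1 ZN.2 q -> `|q| <= C * `|q *m B|.
have Qmono t c c' : c <= c' -> Q t c -> Q t c'.
  move=> cc' Qc tr q qK; apply: (le_trans (Qc tr q qK)).
  by rewrite ler_wpM2r.
have [C C0 QC] := finite_uniform_bound Qmono (fun t => sign_cone_bound B t.1 t.2).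
exists C => // D q D0 oq.
pose Z := [set k | q ord0 k == 0]%SET.
pose N := [set k | q ord0 k < 0]%SET.
apply: (QC (Z, N)) => /=.
- move=> z zK zB.
  have term0 k : 0 <= q ord0 k * z ord0 k / D ord0 k.
    apply: divr_ge0; last exact: ltW.
    have [_ z2 z3] := zK k.
    have [qk|qk] := ltP (q ord0 k) 0.
      by apply: mulr_le0; [exact: ltW | apply: z2; rewrite inE].
    by apply: mulr_ge0 => //; apply: z3; rewrite inE -leNgt.
  have /psumr_eq0P zero : \sum_k q ord0 k * z ord0 k / D ord0 k = 0 by exact: oq.
  apply/rowP => k; rewrite mxE; have [z1 _ _] := zK k.
  have [qk0|qk0] := eqVneq (q ord0 k) 0; first by apply: z1; rewrite inE qk0.
  have /eqP := zero (fun k _ => term0 k) k isT.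
  by rewrite !mulf_eq0 invr_eq0 (negbTE qk0) (gt_eqF (D0 k)) orbF => /eqP.
- move=> k; split; rewrite !inE.
  + by move/eqP.
  + exact: ltW.
  + by rewrite -leNgt.
Qed.

(** * Weighted least squares and critical points *)

Lemma weighted_orth_energy (R : realType) n m (B : 'M[R]_(n, m)) (D q q' : 'rV[R]_n) :
  positive_row D -> weighted_orth B D q -> q' *m B = q *m B ->
  \sum_k (q ord0 k) ^+ 2 / D ord0 k <= \sum_k (q' ord0 k) ^+ 2 / D ord0 k.
Proof.
move=> D0 oq q'q.
have oz : \sum_k q ord0 k * (q' - q) ord0 k / D ord0 k = 0.
  by apply: oq; rewrite mulmxBl q'q subrr.
set z := q' - q in oz *.
rewrite [leLHS](_ : _ = \sum_k q ord0 k ^+ 2 / D ord0 k +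
  2 * \sum_k q ord0 k * z ord0 k / D ord0 k); last by rewrite oz mulr0 addr0.
rewrite mulr_sumr -big_split /=.
apply: ler_sum => k _; rewrite /z !mxE.
have Dk := D0 k; set x := q _ _; set y := q' _ _; set d := D _ _ in Dk *.
rewrite -subr_ge0 (_ : _ - _ = (y - x) ^+ 2 / d); last by field; rewrite gt_eqF.
by rewrite divr_ge0 ?sqr_ge0 // ltW.
Qed.

Lemma weighted_orth_uniq (R : realType) n m (B : 'M[R]_(n, m)) (D q q' : 'rV[R]_n) :
  positive_row D -> weighted_orth B D q -> weighted_orth B D q' -> q *m B = q' *m B ->
  q = q'.
Proof.
move=> D0 oq oq' qq'.
have zB : (q - q') *m B = 0 by rewrite mulmxBl qq' subrr.
have : \sum_k (q - q') ord0 k ^+ 2 / D ord0 k = 0.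
  transitivity (\sum_k q ord0 k * (q - q') ord0 k / D ord0 k -
                \sum_k q' ord0 k * (q - q') ord0 k / D ord0 k).
    by rewrite -sumrB; apply: eq_bigr => k _; rewrite !mxE; ring.
  by rewrite (oq _ zB) (oq' _ zB) subrr.
have term0 k : 0 <= (q - q') ord0 k ^+ 2 / D ord0 k.
  by rewrite divr_ge0 ?sqr_ge0 // ltW.
move/psumr_eq0P => /(_ (fun k _ => term0 k)) zero.
apply/rowP => k; apply/eqP; rewrite -subr_eq0.
have /eqP := zero k isT.
by rewrite mulf_eq0 invr_eq0 (gt_eqF (D0 k)) orbF sqrf_eq0 !mxE.
Qed.

(** Sends [r] to the solution [q] of [q *m B = r] that minimises
    [sum_k q_k^2 / D_k], by the normal equations. *)
Definition weighted_inv (R : realType) n m (B : 'M[R]_(n, m)) (D : 'rV[R]_n) :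
    'M[R]_(m, n) :=
  invmx (B^T *m diag_mx D *m B) *m B^T *m diag_mx D.

Lemma gram_unit (R : realType) n m (B : 'M[R]_(n, m)) (D : 'rV[R]_n) :
  (forall u : 'rV_m, u *m B^T = 0 -> u = 0) -> positive_row D ->
  B^T *m diag_mx D *m B \in unitmx.
Proof.
move=> Binj D0; rewrite -row_free_unit; apply: inj_row_free => u uG.
apply: Binj; set w := u *m B^T.
have : (w *m diag_mx D *m w^T) ord0 ord0 = 0.
  have -> : w *m diag_mx D *m w^T = u *m (B^T *m diag_mx D *m B) *m u^T.
    by rewrite /w trmx_mul trmxK !mulmxA.
  by rewrite uG mul0mx mxE.
rewrite mxE (eq_bigr (fun k => w ord0 k * D ord0 k * w ord0 k)); last first.
  by move=> k _; rewrite mul_mx_diag mxE [w^T _ _]mxE.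
have term0 k : 0 <= w ord0 k * D ord0 k * w ord0 k.
  by rewrite mulrAC -expr2 mulr_ge0 ?sqr_ge0 // ltW.
move=> /psumr_eq0P => /(_ (fun k _ => term0 k)) zero.
apply/rowP => k; rewrite [RHS]mxE; apply/eqP; have /eqP := zero k isT.
by rewrite !mulf_eq0 (gt_eqF (D0 k)) orbF orbb.
Qed.

Lemma weighted_invK (R : realType) n m (B : 'M[R]_(n, m)) (D : 'rV[R]_n) r :
  (forall u : 'rV_m, u *m B^T = 0 -> u = 0) -> positive_row D ->
  r *m weighted_inv B D *m B = r :> 'rV_m.
Proof.
move=> Binj D0; rewrite /weighted_inv -!mulmxA (mulmxA B^T) mulVmx ?mulmx1 //.
exact: gram_unit.
Qed.

Lemma weighted_inv_orth (R : realType) n m (B : 'M[R]_(n, m)) (D : 'rV[R]_n) r :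
  positive_row D -> weighted_orth B D (r *m weighted_inv B D).
Proof.
move=> D0 z zB; rewrite /weighted_inv !mulmxA.
set w := r *m _ *m _.
have : (w *m z^T) ord0 ord0 = 0.
  by rewrite /w -mulmxA -trmx_mul zB trmx0 mulmx0 mxE.
rewrite mxE => E; rewrite -[RHS]E; apply: eq_bigr => k _.
rewrite mul_mx_diag mxE [z^T _ _]mxE; field.
by rewrite gt_eqF.
Qed.

(** The Lagrange condition for maximising the product of the [p_k] at a fixed
    value of [p *m B]. *)
Definition critical (R : realType) n m (B : 'M[R]_(n, m)) (p : 'rV[R]_n) : Prop :=
  positive_row p /\ forall z : 'rV_n, z *m B = 0 -> \sum_k z ord0 k / p ord0 k = 0.

Definition entrywise_mul (R : realType) n (p q : 'rV[R]_n) : 'rV[R]_n :=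
  \row_k (p ord0 k * q ord0 k).

Lemma positive_row_entrywise_mul (R : realType) n (p q : 'rV[R]_n) :
  positive_row p -> positive_row q -> positive_row (entrywise_mul p q).
Proof. by move=> p0 q0 k; rewrite mxE mulr_gt0. Qed.

(** Because [(q_k - p_k) / (p_k q_k) = 1 / p_k - 1 / q_k].  This exact identity
    between two critical points replaces the implicit function theorem. *)
Lemma critical_diff_orth (R : realType) n m (B : 'M[R]_(n, m)) (p q : 'rV[R]_n) :
  critical B p -> critical B q -> weighted_orth B (entrywise_mul p q) (q - p).
Proof.
move=> [p0 cp] [q0 cq] z zB.
transitivity (\sum_k z ord0 k / p ord0 k - \sum_k z ord0 k / q ord0 k).
  rewrite -sumrB; apply: eq_bigr => k _; rewrite !mxE; field.
  by rewrite !gt_eqF.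
by rewrite (cp z zB) (cq z zB) subrr.
Qed.

Lemma prod_first_order (R : realType) (T : finType) (w : T -> R) :
  exists2 C : R, 0 <= C & forall t : R, `|t| <= 1 ->
    `|\prod_k (1 + t * w k) - 1 - t * \sum_k w k| <= C * t ^+ 2.
Proof.
rewrite /index_enum; elim: (Finite.enum T) => [|k s [C C0 IH]].
  by exists 0 => // t _; rewrite !big_nil subrr mulr0 subr0 normr0 mul0r.
exists (`|w k * \sum_(j <- s) w j| + C + `|w k| * C) => [|t t1].
  by rewrite !addr_ge0 // mulr_ge0.
rewrite !big_cons; have := IH t t1.
set S := \sum_(j <- s) w j; set Q := \prod_(j <- s) _.
set e := Q - 1 - t * S => et.
have -> : (1 + t * w k) * Q - 1 - t * (w k + S) = t ^+ 2 * (w k * S) + e + t * w k * e.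
  by rewrite /e; ring.
rewrite (le_trans (ler_normD _ _)) // !mulrDl lerD //.
  rewrite (le_trans (ler_normD _ _)) // lerD //.
  by rewrite normrM ger0_norm ?sqr_ge0 // mulrC.
rewrite !normrM -!mulrA; apply: (@le_trans _ _ (`|w k| * `|e|)).
  by rewrite ler_piMl // mulr_ge0.
by rewrite ler_wpM2l.
Qed.

(** A maximiser of the product over the compact set of nonnegative solutions. It
    has positive entries since some positive solution exists, and the first
    order term of the product along a kernel vector has to vanish. *)
Lemma critical_exists (R : realType) n m (B : 'M[R]_(n, m)) (r : 'rV[R]_m) :
  (exists M, forall p : 'rV_n, (forall k, 0 <= p ord0 k) -> p *m B = r -> `|p| <= M) ->
  (exists2 p : 'rV_n, positive_row p & p *m B = r) ->
  exists2 p : 'rV_n, critical B p & p *m B = r.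
Proof.
move=> [M bM] [p0 p0pos p0r].
pose K := @sign_cone R n (@finset.set0 _) (@finset.set0 _) `&` [set p | p *m B = r].
have KE p : K p <-> (forall k, 0 <= p ord0 k) /\ p *m B = r.
  split=> [[pc pr]|[p1 p2]]; split=> // k.
    by have [_ _] := pc k; apply; rewrite inE.
  by split; rewrite ?inE.
have Kp0 : K p0 by apply/KE; split=> // k; exact: ltW.
have cK : compact K.
  apply: bounded_closed_compact.
    exists M; split; first exact: num_real.
    move=> M' MM' p /KE[p1 p2]; exact: le_trans (bM p p1 p2) (ltW MM').
  apply: closedI; first exact: sign_cone_closed.
  apply: (@closed_comp _ _ (fun q : 'rV[R]_n => q *m B) [set r]).
    by move=> q _; exact: mulmx_continuous.
  exact/accessible_closed_set1/hausdorff_accessible/norm_hausdorff.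
have cf : {within K, continuous (fun p : 'rV[R]_n => \prod_k p ord0 k)}.
  apply: continuous_subspaceT => p.
  apply: (@cvg_big R 'I_n *%R 1 xpredT _ _ (nbhs p) (index_enum _)
    (fun k (p : 'rV[R]_n) => p ord0 k) (fun k => p ord0 k)).
    exact: mul_continuous.
  by move=> k _; exact: coord_continuous.
have [p + maxp] := EVT_max_rV (ex_intro _ p0 Kp0) cK cf.
rewrite inE => /KE[p1 p2]; exists p => //.
have prodp : 0 < \prod_k p ord0 k.
  apply: (@lt_le_trans _ _ (\prod_k p0 ord0 k)); last by apply: maxp; rewrite inE.
  by apply: prodr_gt0.
have ppos : positive_row p.
  move=> k; rewrite lt_neqAle p1 andbT eq_sym.
  by move: prodp; rewrite lt_neqAle eq_sym => /andP[/prodf_neq0 -/(_ k isT)].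
split=> // z zB.
pose w k := z ord0 k / p ord0 k.
have [C C0 expC] := prod_first_order w.
set s := \sum_k _; apply/eqP; apply/negPn/negP => s0.
pose A := \sum_k `|w k|.
have A0 : 0 <= A by exact: sumr_ge0.
(* Small enough for [p + t *: z] to stay nonnegative and for the quadratic error
   [C * t ^+ 2] to be dominated by the linear term [t * s = s ^+ 2 * e]. *)
pose e := (1 + C + `|s| + `|s| * A)^-1.
have den : 0 < 1 + C + `|s| + `|s| * A.
  by rewrite !ltr_wpDr // mulr_ge0.
have e0 : 0 < e by rewrite invr_gt0.
have eden : e * (1 + C + `|s| + `|s| * A) = 1 by rewrite mulVf // gt_eqF.
pose t := s * e.
have t1 : `|t| <= 1.
  rewrite normrM (gtr0_norm e0) -eden mulrC ler_wpM2l ?ltW //.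
  have sA : 0 <= `|s| * A by rewrite mulr_ge0.
  by have := normr_ge0 s; lra.
have tw k : `|t * w k| <= 1.
  rewrite normrM normrM (gtr0_norm e0) -eden [`|s| * e]mulrC -mulrA.
  rewrite ler_wpM2l ?ltW //.
  have : `|s| * `|w k| <= `|s| * A.
    by rewrite ler_wpM2l // /A (bigD1 k) //= lerDl sumr_ge0.
  by have := normr_ge0 s; move=> *; lra.
have Kz : K (p + t *: z).
  apply/KE; split=> [k|]; last by rewrite mulmxDl -scalemxAl zB scaler0 addr0.
  rewrite !mxE (_ : _ + _ = p ord0 k * (1 + t * w k)); last first.
    by rewrite /w; field; rewrite gt_eqF.
  rewrite mulr_ge0 //.
  have := tw k; rewrite ler_norml => /andP[+ _]; rewrite -subr_ge0; lra.
have := maxp (p + t *: z); rewrite inE => /(_ Kz).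
rewrite (eq_bigr (fun k => p ord0 k * (1 + t * w k))); last first.
  by move=> k _; rewrite !mxE /w; field; rewrite gt_eqF.
rewrite big_split /= ger_pMr // => le1.
have := expC t t1; rewrite ler_norml => /andP[+ _].
rewrite -/s => lo.
have : s ^+ 2 * e * (1 - C * e) <= 0.
  have -> : s ^+ 2 * e * (1 - C * e) = t * s - C * t ^+ 2 by rewrite /t; ring.
  by move: lo le1; set X := \prod_k _; lra.
apply/negP; rewrite -ltNge mulr_gt0 //.
  by rewrite mulr_gt0 // lt_neqAle sqr_ge0 eq_sym sqrf_eq0 s0.
rewrite subr_gt0 -eden mulrC ltr_pM2l //.
have sA : 0 <= `|s| * A by rewrite mulr_ge0.
by have := normr_ge0 s; lra.
Qed.

(** * Derivatives from slopes, and rational functions of given functions *)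

Lemma dot_is_linear (R : realType) d (c : 'rV[R]_d) :
  linear (dot c : 'rV[R]_d -> R^o).
Proof.
move=> k u v; rewrite /dot /GRing.scale /= mulr_sumr -big_split /=.
by apply: eq_bigr => i _; rewrite !mxE; ring.
Qed.

HB.instance Definition _ (R : realType) d (c : 'rV[R]_d) :=
  GRing.isLinear.Build R 'rV[R]_d R^o *:%R (dot c) (dot_is_linear c).

Lemma dot_mulmx (R : realType) d (c h : 'rV[R]_d) : dot c h = (h *m c^T) ord0 ord0.
Proof. by rewrite mxE; apply: eq_bigr => i _; rewrite mxE mulrC. Qed.

Lemma dot_continuous (R : realType) d (c : 'rV[R]_d) : continuous (dot c).
Proof.
move=> h; rewrite (_ : dot c = (fun u : 'rV[R]_1 => u ord0 ord0) \o (fun h => h *m c^T)).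
  by apply: continuous_comp; [exact: mulmx_continuous | exact: coord_continuous].
by apply/funext => u /=; rewrite dot_mulmx.
Qed.

(** Caratheodory's criterion: an exact slope that is continuous at [x] is a
    derivative at [x]. *)
Lemma differentiable_of_slope (R : realType) d (f : 'rV[R]_d -> R) (x : 'rV[R]_d)
    (G : 'rV[R]_d -> 'rV[R]_d) :
  (\forall y \near x, f y - f x = dot (G y) (y - x)) ->
  (forall i, {for x, continuous (fun y => G y ord0 i)}) ->
  differentiable f x /\ forall i, partial i f x = G x ord0 i.
Proof.
move=> fG cG.
have o1 : f \o shift x = cst (f x) + (dot (G x) : _ -> R^o) +o_ (0 : 'rV[R]_d) id.
  apply/eqaddoP => e e0.
  have e1 : 0 < e / d.+1%:R by rewrite divr_gt0.
  have : \forall y \near x, `|f y - f x - dot (G x) (y - x)| <= e * `|y - x|.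
    have Gnear : \forall y \near x, forall i, `|G x ord0 i - G y ord0 i| <= e / d.+1%:R.
      apply: (@filter_forall _ _ (fun i y => `|G x ord0 i - G y ord0 i| <= e / d.+1%:R)
        (nbhs x) (nbhs_filter x)) => i.
      exact: ((@cvgrPdist_le _ _ _ (nbhs x) (nbhs_filter x) _ _).1 (cG i)).
    apply: filterS2 fG Gnear => y -> Gy.
    have -> : dot (G y) (y - x) - dot (G x) (y - x) =
        \sum_i (G y ord0 i - G x ord0 i) * (y - x) ord0 i.
      by rewrite -sumrB; apply: eq_bigr => i _; rewrite mulrBl.
    apply: (le_trans (ler_norm_sum _ _ _)).
    apply: (@le_trans _ _ (\sum_(i < d) e / d.+1%:R * `|y - x|)).
      apply: ler_sum => i _; rewrite normrM distrC ler_pM //.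
      exact: ler_coord_norm.
    rewrite sumr_const card_ord -[leLHS]mulr_natl mulrA ler_wpM2r // mulrCA ler_piMr ?(ltW e0) //.
    by rewrite ler_pdivrMr // mul1r ler_nat.
  rewrite (near_shift 0 x) => near0.
  near=> h.
  have : `|f (h + (x - 0)) - f x - dot (G x) (h + (x - 0) - x)| <= e * `|h + (x - 0) - x|.
    by near: h.
  by rewrite subr0 addrK /= !fctE /= opprD addrA.
have dG : 'd f x = dot (G x) :> (_ -> _).
  by apply: (@diff_unique _ _ _ f (dot (G x)) x _ o1); exact: dot_continuous.
have df : differentiable f x.
  by apply/diff_locallyP; rewrite dG; split; [exact: dot_continuous|].
split=> // i; rewrite /partial deriveE // dG /dot.
rewrite (bigD1 i) //= big1 ?addr0 => [|j ji]; first by rewrite mxE !eqxx mulr1.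
by rewrite mxE (negbTE ji) andbF mulr0.
Unshelve. all: by end_near. Qed.

Lemma continuous_near_eq (R : realType) d (x : 'rV[R]_d) (f g : 'rV[R]_d -> R) :
  (\near x, f x = g x) -> {for x, continuous f} -> {for x, continuous g}.
Proof.
move=> fg; rewrite /prop_for /continuous_at (nbhs_singleton fg) => cf.
by apply: cvg_trans cf; apply: (@near_eq_cvg _ _ (nbhs x) (nbhs_filter x)).
Qed.

Lemma differentiable_near_eq (R : realType) d (x : 'rV[R]_d) (f g : 'rV[R]_d -> R) :
  (\near x, f x = g x) -> differentiable f x -> differentiable g x.
Proof.
move=> fg df.
have /diff_locallyP[cdf /eqaddoP of1] := df.
have og : g \o shift x = cst (g x) + 'd f x +o_ (0 : 'rV[R]_d) id.
  apply/eqaddoP => e e0; have := of1 e e0.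
  have : \forall h \near (0 : 'rV[R]_d), f (h + x) = g (h + x).
    move: fg; rewrite (near_shift 0 x); apply: filterS => h /=.
    by rewrite subr0.
  apply: filterS2 => h /= fgh; rewrite !fctE /= fgh.
  by rewrite (nbhs_singleton fg).
have dg : 'd g x = 'd f x :> (_ -> _) by exact: diff_unique og.
by apply/diff_locallyP; rewrite dg.
Qed.

(** The functions obtained from the [p k] by rational operations, up to equality
    on [U].  Closure under [RatExt] lets a partial derivative, which is known
    only on [U], belong to the class. *)
Inductive rational_in (R : realType) d n (U : set 'rV[R]_d)
    (p : 'I_n -> 'rV[R]_d -> R) : ('rV[R]_d -> R) -> Prop :=
| RatCst c : rational_in U p (fun=> c)
| RatGen k : rational_in U p (p k)
| RatAdd f g : rational_in U p f -> rational_in U p g ->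
    rational_in U p (fun x => f x + g x)
| RatMul f g : rational_in U p f -> rational_in U p g ->
    rational_in U p (fun x => f x * g x)
| RatInv f : rational_in U p f -> (forall x, U x -> f x != 0) ->
    rational_in U p (fun x => (f x)^-1)
| RatExt f g : rational_in U p f -> (forall x, U x -> f x = g x) ->
    rational_in U p g.

Section Rational.
Context (R : realType) (d n : nat) (U : set 'rV[R]_d) (p : 'I_n -> 'rV[R]_d -> R).
Context (openU : open U).

Let nearU x f g : U x -> (forall y : 'rV[R]_d, U y -> f y = g y :> R) ->
  \near x, f x = g x.
Proof. by move=> Ux fg; apply: filterS (open_nbhs_nbhs (conj openU Ux)). Qed.

Lemma rational_continuous f x : (forall k, {for x, continuous (p k)}) -> U x ->
  rational_in U p f -> {for x, continuous f}.
Proof.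
move=> cp Ux; elim=> {f} [c|k|f g _ cf _ cg|f g _ cf _ cg|f _ cf f0|f g _ cf fg].
- exact: cst_continuous.
- exact: cp.
- exact: continuousD.
- exact: continuousM.
- by apply: continuousV => //; exact: f0.
- by apply: continuous_near_eq cf; exact: nearU.
Qed.

Lemma rational_differentiable f x : (forall k, differentiable (p k) x) -> U x ->
  rational_in U p f -> differentiable f x.
Proof.
move=> cp Ux; elim=> {f} [c|k|f g _ cf _ cg|f g _ cf _ cg|f _ cf f0|f g _ cf fg].
- exact: differentiable_cst.
- exact: cp.
- exact: differentiableD.
- exact: differentiableM.
- by apply: differentiableV => //; exact: f0.
- by apply: differentiable_near_eq cf; exact: nearU.
Qed.

Lemma rational_partial f i :
  (forall k x, U x -> differentiable (p k) x) ->
  (forall k, rational_in U p (partial i (p k))) ->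
  rational_in U p f -> rational_in U p (partial i f).
Proof.
move=> dp rp; have df h : rational_in U p h -> forall x, U x -> derivable h x (delta_mx ord0 i).
  by move=> rf x Ux; apply: diff_derivable; apply: (rational_differentiable _ Ux rf) => k; exact: dp.
elim=> {f} [c|k|f g rf rf' rg rg'|f g rf rf' rg rg'|f rf rf' f0|f g rf rf' fg].
- apply: (RatExt (RatCst U p 0)) => x _.
  by rewrite /partial derive_cst.
- exact: rp.
- apply: (RatExt (RatAdd rf' rg')) => x Ux; rewrite /partial deriveD //; exact: df.
- apply: (RatExt (RatAdd (RatMul rf rg') (RatMul rg rf'))) => x Ux.
  by rewrite /partial deriveM //; exact: df.
- apply: (RatExt (RatMul (RatMul (RatCst U p (-1)) (RatInv (RatMul rf rf) _)) rf')) => [x Ux|x Ux].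
    by rewrite mulf_neq0 // f0.
  rewrite /partial deriveV //; [|exact: f0|exact: df].
  by rewrite /GRing.scale /= expr2 mulN1r.
- apply: (RatExt rf') => x Ux; rewrite /partial; apply: near_eq_derive.
  exact: nearU.
Qed.

(** The class is stable under partial derivatives as soon as the derivatives of
    the generators belong to it, so differentiability propagates to all
    orders. *)
Lemma rational_smooth f :
  (forall k x, U x -> differentiable (p k) x) ->
  (forall k i, rational_in U p (partial i (p k))) ->
  rational_in U p f -> smooth_on U f.
Proof.
move=> dp rp rf s; have rs : rational_in U p (foldr (@partial R d) f s).
  by elim: s => //= i s; apply: rational_partial.
move=> x Ux; apply: (rational_differentiable _ Ux rs) => k; exact: dp.
Qed.

Lemma rational_sum (I : Type) (s : seq I) (P : pred I) (F : I -> 'rV[R]_d -> R) :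
  (forall i, rational_in U p (F i)) ->
  rational_in U p (fun x => \sum_(i <- s | P i) F i x).
Proof.
move=> rF; elim: s => [|i s IH].
  by apply: (RatExt (RatCst U p 0)) => x _; rewrite big_nil.
have [Pi|nPi] := boolP (P i).
  by apply: (RatExt (RatAdd (rF i) IH)) => x _; rewrite big_cons Pi.
by apply: (RatExt IH) => x _; rewrite big_cons (negbTE nPi).
Qed.

Lemma rational_prod (I : Type) (s : seq I) (P : pred I) (F : I -> 'rV[R]_d -> R) :
  (forall i, rational_in U p (F i)) ->
  rational_in U p (fun x => \prod_(i <- s | P i) F i x).
Proof.
move=> rF; elim: s => [|i s IH].
  by apply: (RatExt (RatCst U p 1)) => x _; rewrite big_nil.
have [Pi|nPi] := boolP (P i).
  by apply: (RatExt (RatMul (rF i) IH)) => x _; rewrite big_cons Pi.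
by apply: (RatExt IH) => x _; rewrite big_cons (negbTE nPi).
Qed.

Lemma rational_det m (M : 'rV[R]_d -> 'M[R]_m) :
  (forall i j, rational_in U p (fun x => M x i j)) ->
  rational_in U p (fun x => \det (M x)).
Proof.
move=> rM; rewrite /determinant; apply: rational_sum => s.
by apply: RatMul; [exact: RatCst | apply: rational_prod => i; exact: rM].
Qed.

(** Cramer's rule. *)
Lemma rational_invmx m (M : 'rV[R]_d -> 'M[R]_m) :
  (forall x, U x -> M x \in unitmx) ->
  (forall i j, rational_in U p (fun x => M x i j)) ->
  forall i j, rational_in U p (fun x => invmx (M x) i j).
Proof.
move=> uM rM i j.
have rcof : rational_in U p (fun x => cofactor (M x) j i).
  rewrite /cofactor; apply: RatMul; first exact: RatCst.
  apply: rational_det => k l.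
  by apply: (RatExt (rM (lift j k) (lift i l))) => x _; rewrite !mxE.
apply: (RatExt (RatMul (RatInv (rational_det rM) _) rcof)) => [x Ux|x Ux].
  by have := uM x Ux; rewrite unitmxE unitfE.
by rewrite /invmx uM // !mxE.
Qed.

Lemma rational_mulmx a b c (M : 'rV[R]_d -> 'M[R]_(a, b)) (N : 'rV[R]_d -> 'M[R]_(b, c)) :
  (forall i j, rational_in U p (fun x => M x i j)) ->
  (forall i j, rational_in U p (fun x => N x i j)) ->
  forall i j, rational_in U p (fun x => (M x *m N x) i j).
Proof.
move=> rM rN i j.
apply: (@RatExt _ _ _ _ _ (fun x => \sum_k M x i k * N x k j)) => [|x _].
  by apply: rational_sum => k; exact: RatMul.
by rewrite mxE.
Qed.

Lemma rational_weighted_inv m (B : 'M[R]_(n, m)) (D : 'rV[R]_d -> 'rV[R]_n) (r : 'rV[R]_m) :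
  (forall u : 'rV_m, u *m B^T = 0 -> u = 0) ->
  (forall x, U x -> positive_row (D x)) ->
  (forall k, rational_in U p (fun x => D x ord0 k)) ->
  forall k, rational_in U p (fun x => (r *m weighted_inv B (D x)) ord0 k).
Proof.
move=> Binj D0 rD k.
have rdiag i j : rational_in U p (fun x => diag_mx (D x) i j).
  have [->|ij] := eqVneq i j.
    by apply: (RatExt (rD j)) => x _; rewrite mxE eqxx mulr1n.
  by apply: (RatExt (RatCst U p 0)) => x _; rewrite mxE (negbTE ij) mulr0n.
have rc a b (M : 'M[R]_(a, b)) i j : rational_in U p (fun=> M i j) by exact: RatCst.
apply: rational_mulmx => // i j; apply: rational_mulmx => // {}i {}j.
apply: rational_mulmx => // {}i {}j; apply: rational_invmx => [x Ux|{}i {}j].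
  by apply: gram_unit => //; exact: D0.
by apply: rational_mulmx => // {}i {}j; apply: rational_mulmx.
Qed.

End Rational.

(** * Lipschitz extension, barycentric combinations and scalar products *)

(** McShane's extension: the infimum of the cones [f y + C |x - y|]. *)
Lemma lipschitz_extension (R : realType) (V : normedModType R) (U : set V)
    (f : V -> R) (C : R) :
  U !=set0 -> 0 <= C ->
  (forall x y, U x -> U y -> `|f x - f y| <= C * `|x - y|) ->
  exists2 g : V -> R, (forall x, U x -> g x = f x) &
    forall x y, `|g x - g y| <= C * `|x - y|.
Proof.
move=> [y0 Uy0] C0 lf.
pose A x := [set f y + C * `|x - y| | y in U].
have lbA x : has_lbound (A x).
  exists (f y0 - C * `|x - y0|) => _ [y Uy <-].
  have := lf _ _ Uy Uy0; rewrite ler_norml => /andP[+ _].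
  have : C * `|y - y0| <= C * `|x - y0| + C * `|x - y|.
    by rewrite -mulrDr ler_wpM2l // [leRHS]addrC (distrC x y) ler_distD.
  lra.
have A0 x : A x !=set0 by exists (f y0 + C * `|x - y0|); exists y0.
have gle x y : inf (A x) - C * `|x - y| <= inf (A y).
  apply: lb_le_inf => // _ [z Uz <-].
  have : inf (A x) <= f z + C * `|x - z| by apply: ge_inf => //; exists z.
  have : C * `|x - z| <= C * `|x - y| + C * `|y - z|.
    by rewrite -mulrDr ler_wpM2l // ler_distD.
  lra.
exists (fun x => inf (A x)) => [x Ux|x y].
  apply/eqP; rewrite eq_le; apply/andP; split.
    by apply: ge_inf => //; exists x => //; rewrite subrr normr0 mulr0 addr0.
  apply: lb_le_inf => // _ [y Uy <-].
  have := lf _ _ Ux Uy; rewrite ler_norml => /andP[_].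
  lra.
have := gle x y; have := gle y x; rewrite [`|y - x|]distrC ler_norml.
move=> *; apply/andP; split; lra.
Qed.

(** With the points extended by a coordinate 1, affine relations between them
    become linear relations between the rows of a matrix. *)
Definition bary_mx (R : realType) d n (a : 'I_n -> 'rV[R]_d) : 'M[R]_(n, d + 1) :=
  row_mx (\matrix_k a k) (const_mx 1).

Definition homog (R : realType) d (c : R) (x : 'rV[R]_d) : 'rV[R]_(d + 1) :=
  row_mx x (const_mx c).

Lemma mulmx_bary (R : realType) d n (a : 'I_n -> 'rV[R]_d) (q : 'rV[R]_n) :
  q *m bary_mx a = homog (\sum_k q ord0 k) (\sum_k q ord0 k *: a k).
Proof.
rewrite /bary_mx mul_mx_row; congr row_mx.
  by rewrite mulmx_sum_row; apply: eq_bigr => k _; rewrite rowK.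
by apply/rowP => j; rewrite !mxE; apply: eq_bigr => k _; rewrite mxE mulr1.
Qed.

Lemma homog_inj (R : realType) d (c c' : R) (x x' : 'rV[R]_d) :
  homog c x = homog c' x' -> c = c' /\ x = x'.
Proof.
move=> /eq_row_mx[-> /rowP /(_ ord0)]; rewrite !mxE => ->; by [].
Qed.

Lemma homogB (R : realType) d (c c' : R) (x x' : 'rV[R]_d) :
  homog c x - homog c' x' = homog (c - c') (x - x').
Proof.
rewrite /homog opp_row_mx add_row_mx; congr row_mx.
by apply/rowP => j; rewrite !mxE.
Qed.

Lemma homogZ (R : realType) d (k c : R) (x : 'rV[R]_d) :
  k *: homog c x = homog (k * c) (k *: x).
Proof.
rewrite /homog scale_row_mx; congr row_mx.
by apply/rowP => j; rewrite !mxE.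
Qed.

Lemma homogD (R : realType) d (c c' : R) (x x' : 'rV[R]_d) :
  homog c x + homog c' x' = homog (c + c') (x + x').
Proof.
rewrite /homog add_row_mx; congr row_mx.
by apply/rowP => j; rewrite !mxE.
Qed.

Lemma norm_homog0 (R : realType) d (x : 'rV[R]_d) : `|homog 0 x| <= `|x|.
Proof.
apply: rV_norm_le => // j; rewrite /homog mxE; case: (fintype.split j) => k.
  exact: ler_coord_norm.
by rewrite mxE normr0.
Qed.

Definition in_hull (R : realType) d n (a : 'I_n -> 'rV[R]_d) (x : 'rV[R]_d) : Prop :=
  exists2 mu : 'rV[R]_n, (forall k, 0 <= mu ord0 k) & mu *m bary_mx a = homog 1 x.

Lemma in_hull_vertex (R : realType) d n (a : 'I_n -> 'rV[R]_d) k : in_hull a (a k).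
Proof.
exists (delta_mx ord0 k) => [j|]; first by rewrite mxE eqxx ler0n.
rewrite mulmx_bary (bigD1 k) //= big1 ?addr0 => [|j jk]; last first.
  by rewrite mxE (negbTE jk) andbF.
rewrite (bigD1 k) //= big1 ?addr0 => [|j jk]; last first.
  by rewrite mxE (negbTE jk) andbF scale0r.
by rewrite mxE !eqxx scale1r.
Qed.

Lemma in_hull_convex (R : realType) d n (a : 'I_n -> 'rV[R]_d) (s t : R) x y :
  0 <= s -> 0 <= t -> s + t = 1 -> in_hull a x -> in_hull a y ->
  in_hull a (s *: x + t *: y).
Proof.
move=> s0 t0 st [mu mu0 mux] [nu nu0 nuy].
exists (s *: mu + t *: nu) => [k|]; first by rewrite !mxE addr_ge0 // mulr_ge0.
by rewrite mulmxDl -!scalemxAl mux nuy !homogZ homogD !mulr1 st.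
Qed.

Lemma dotC (R : realType) d (u v : 'rV[R]_d) : dot u v = dot v u.
Proof. by apply: eq_bigr => i _; rewrite mulrC. Qed.

Lemma dotDr (R : realType) d (u v w : 'rV[R]_d) : dot u (v + w) = dot u v + dot u w.
Proof. exact: (linearD (dot u)). Qed.

Lemma dotBr (R : realType) d (u v w : 'rV[R]_d) : dot u (v - w) = dot u v - dot u w.
Proof. exact: (linearB (dot u)). Qed.

Lemma dotZr (R : realType) d (k : R) (u v : 'rV[R]_d) : dot u (k *: v) = k * dot u v.
Proof. exact: (linearZ_LR (dot u)). Qed.

Lemma dot_sumr (R : realType) d (I : finType) (P : pred I) (u : 'rV[R]_d) (F : I -> 'rV[R]_d) :
  dot u (\sum_(i | P i) F i) = \sum_(i | P i) dot u (F i).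
Proof. exact: (linear_sum (dot u)). Qed.

Lemma dotZl (R : realType) d (k : R) (u v : 'rV[R]_d) : dot (k *: u) v = k * dot u v.
Proof. by rewrite dotC dotZr dotC. Qed.

Lemma dot_suml (R : realType) d (I : finType) (P : pred I) (u : 'rV[R]_d) (F : I -> 'rV[R]_d) :
  dot (\sum_(i | P i) F i) u = \sum_(i | P i) dot (F i) u.
Proof. by rewrite dotC dot_sumr; apply: eq_bigr => i _; rewrite dotC. Qed.

Lemma dot0r (R : realType) d (u : 'rV[R]_d) : dot u 0 = 0.
Proof. exact: (linear0 (dot u)). Qed.

Lemma dotNr (R : realType) d (u v : 'rV[R]_d) : dot u (- v) = - dot u v.
Proof. exact: (linearN (dot u)). Qed.

Lemma dot_ge0 (R : realType) d (v : 'rV[R]_d) : 0 <= dot v v.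
Proof. by apply: sumr_ge0 => i _; rewrite -expr2 sqr_ge0. Qed.

Lemma dot_eq0 (R : realType) d (v : 'rV[R]_d) : dot v v = 0 -> v = 0.
Proof.
move/psumr_eq0P => v0; apply/rowP => i; rewrite mxE; apply/eqP.
rewrite -sqrf_eq0 expr2; apply/eqP/v0 => // j _.
by rewrite -expr2 sqr_ge0.
Qed.

(** * Polyhedra given by inequalities *)

Definition hrep (R : realType) d m (c : 'I_m -> 'rV[R]_d) (b : 'I_m -> R) :
    set 'rV[R]_d :=
  [set x | forall i, dot (c i) x <= b i].

Definition irredundant (R : realType) d m (c : 'I_m -> 'rV[R]_d) (b : 'I_m -> R) : Prop :=
  forall i, exists2 z, b i < dot (c i) z & forall j, j != i -> dot (c j) z <= b j.

(** A description with the least number of inequalities: a point violating only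
    the inequality [i] exists, since otherwise [i] could be dropped. *)
Lemma irredundant_hrep (R : realType) d (P : set 'rV[R]_d) : polyhedron P ->
  exists m (c : 'I_m -> 'rV[R]_d) (b : 'I_m -> R), P = hrep c b /\ irredundant c b.
Proof.
move=> [m0 [c0 [b0 P0]]].
pose Q m := `[< exists (c : 'I_m -> 'rV[R]_d) (b : 'I_m -> R), P = hrep c b >].
have exQ : exists m, Q m by exists m0; apply/asboolP; exists c0, b0.
case: (ex_minnP exQ) => m /asboolP[c [b Pcb]] minm.
exists m, c, b; split=> // i; apply: contrapT => noz.
case: m => [|m] in c b Pcb minm i noz *; first by case: i noz.
have : Q m.
  apply/asboolP; exists (fun j => c (lift i j)), (fun j => b (lift i j)).
  rewrite Pcb; apply/seteqP; split=> x /= Px; first by move=> j; exact: Px.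
  have Px' j : j != i -> dot (c j) x <= b j.
    by rewrite eq_sym => /unlift_some[k -> _]; exact: Px.
  move=> j; have [->|/Px'//] := eqVneq j i.
  by rewrite leNgt; apply/negP => bx; apply: noz; exists x.
by move=> /minm; rewrite ltnn.
Qed.

(** The sum of the active constraints is maximal exactly where all of them are
    active, and this happens at a single point when their normals have no common
    orthogonal vector. *)
Lemma active_rank_vertex (R : realType) d m (c : 'I_m -> 'rV[R]_d) (b : 'I_m -> R) x :
  hrep c b x ->
  (forall v, (forall i, dot (c i) x = b i -> dot (c i) v = 0) -> v = 0) ->
  vertices (hrep c b) x.
Proof.
move=> Px rk; pose A := [pred i | dot (c i) x == b i].
exists (\sum_(i | A i) c i), (\sum_(i | A i) b i); split.
  by move=> y Py; rewrite dot_suml ler_sum // => i _; exact: Py.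
apply/seteqP; split=> [_ ->|y [Py]].
  by split=> //; rewrite dot_suml; apply: eq_bigr => i /eqP.
rewrite dot_suml => sy; apply/eqP; rewrite -subr_eq0; apply/eqP/rk => i ix.
have zero : \sum_(j | A j) (b j - dot (c j) y) = 0 by rewrite sumrB sy subrr.
have b0 j : A j -> 0 <= b j - dot (c j) y by rewrite subr_ge0 Py.
rewrite dotBr ix -opprB (psumr_eq0P b0 zero) ?oppr0 //.
by rewrite /A /= ix.
Qed.

Section Bounded.
Context (R : realType) (d m : nat) (c : 'I_m -> 'rV[R]_d) (b : 'I_m -> R).
Context (bP : bounded_set (hrep c b)).

Lemma bounded_recession x v : hrep c b x -> v != 0 -> exists j, 0 < dot (c j) v.
Proof.
move=> Px v0; apply: contrapT => nj.
have vle j : dot (c j) v <= 0 by rewrite leNgt; apply/negP => ?; apply: nj; exists j.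
have [M [Mr bM]] := bP.
have {}bM y : hrep c b y -> `|y| <= M + 1 by apply: bM; rewrite ltrDl.
pose t := (`|M + 1| + `|x| + 1) / `|v|.
have t0 : 0 <= t by rewrite divr_ge0 // !addr_ge0.
have /bM : hrep c b (x + t *: v).
  move=> j; rewrite dotDr dotZr; have := Px j; have := vle j => ? ?.
  by rewrite -[leRHS]addr0 lerD // mulr_ge0_le0.
apply/negP; rewrite -ltNge.
have : `|t *: v| <= `|x + t *: v| + `|x|.
  by rewrite -[X in `|X| <= _](addrK x) [t *: v + x]addrC ler_normB.
rewrite normrZ (ger0_norm t0) divfK ?normr_eq0 //.
have := ler_norm (M + 1); lra.
Qed.

(** Leaving a bounded polyhedron along a line: the first constraint reached
    becomes active at the exit point. *)
Lemma hrep_exit x v : hrep c b x -> v != 0 ->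
  exists2 t, 0 <= t & hrep c b (x + t *: v) /\
    exists2 j, 0 < dot (c j) v & dot (c j) (x + t *: v) = b j.
Proof.
move=> Px v0; have [j0 j0v] := bounded_recession Px v0.
pose F j := (b j - dot (c j) x) / dot (c j) v.
have [j jv minj] := @arg_minP _ _ _ j0 (fun j => 0 < dot (c j) v) F j0v.
exists (F j); first by rewrite divr_ge0 ?subr_ge0 ?(ltW jv).
split; last first.
  by exists j => //; rewrite dotDr dotZr /F divfK ?gt_eqF // subrKC.
move=> k; rewrite dotDr dotZr; have [kv|kv] := ltP 0 (dot (c k) v).
  by rewrite -lerBrDl -ler_pdivlMr //; exact: minj.
rewrite -[leRHS]addr0 lerD //.
by rewrite mulr_ge0_le0 // divr_ge0 ?subr_ge0 ?(ltW jv).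
Qed.

(** By induction on the number of inactive constraints.  A point that is not a
    vertex lies between two exit points along a direction orthogonal to all active
    normals, where strictly more constraints are active. *)
Lemma hrep_hull n (a : 'I_n -> 'rV[R]_d) :
  vertices (hrep c b) `<=` range a -> hrep c b `<=` in_hull a.
Proof.
move=> va.
pose act x := [set i | dot (c i) x == b i]%SET.
(* [k] strictly bounds the number of inactive constraints. *)
suff H k : forall x, hrep c b x -> (#|~: act x| < k)%N -> in_hull a x.
  by move=> x Px; exact: (H #|~: act x|.+1).
elim: k => [//|k IH] x Px; rewrite ltnS => leqk.
have [rk|/existsNP[v /not_implyP[va0 /eqP v0]]] :=
    pselect (forall v, (forall i, dot (c i) x = b i -> dot (c i) v = 0) -> v = 0).
  by have /va[j _ <-] := active_rank_vertex Px rk; exact: in_hull_vertex.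
have exit w : w != 0 -> (forall i, dot (c i) x = b i -> dot (c i) w = 0) ->
    exists2 t, 0 < t & in_hull a (x + t *: w).
  move=> w0 wa0; have [t t0 [Pt [j jw jt]]] := hrep_exit Px w0.
  have jx : dot (c j) x != b j.
    by apply/negP => /eqP /wa0 jw0; move: jw; rewrite jw0 ltxx.
  exists t.
    rewrite lt_neqAle t0 andbT; apply/negP => /eqP t00.
    by move: jx; rewrite -jt -t00 scale0r addr0 eqxx.
  apply: IH => //; apply: leq_trans leqk; apply: proper_card; apply/properP; split.
    apply/fintype.subsetP => i; rewrite !inE; apply: contra => /eqP ix.
    by rewrite dotDr dotZr (wa0 i ix) mulr0 addr0 ix.
  by exists j; rewrite !inE // jt eqxx.
have [t t0 ht] := exit v v0 va0.
have [s s0 hs] : exists2 s, 0 < s & in_hull a (x + s *: - v).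
  by apply: exit => [|i /va0 iv]; rewrite ?oppr_eq0 // dotNr iv oppr0.
have st0 : s + t != 0 by rewrite gt_eqF // addr_gt0.
have -> : x = (s / (s + t)) *: (x + t *: v) + (t / (s + t)) *: (x + s *: - v).
  by apply/rowP => i; rewrite !mxE; field.
apply: in_hull_convex => //; first by rewrite divr_ge0 ?addr_ge0 // ltW.
  by rewrite divr_ge0 ?addr_ge0 // ltW.
by rewrite -mulrDl divff.
Qed.

End Bounded.

Lemma dot_bounded (R : realType) d (u : 'rV[R]_d) :
  exists2 C, 0 <= C & forall v, `|dot u v| <= C * `|v|.
Proof.
exists (\sum_i `|u ord0 i|); first exact: sumr_ge0.
move=> v; rewrite mulr_suml; apply: (le_trans (ler_norm_sum _ _ _)).
by apply: ler_sum => i _; rewrite normrM ler_wpM2l // ler_coord_norm.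
Qed.

Lemma span_dot_eq0 (R : realType) d (X : seq 'rV[R]_d) (v : 'rV[R]_d) :
  <<X>>%VS = fullv -> (forall u, u \in X -> dot v u = 0) -> v = 0.
Proof.
move=> spX vX; apply: dot_eq0.
pose f := linfun (dot v : 'rV[R]_d -> R^o).
have : (<<X>> <= lker f)%VS.
  by apply/span_subvP => u uX; rewrite memv_ker lfunE /= vX.
rewrite spX => /subvP /(_ v (memvf v)).
by rewrite memv_ker lfunE /= => /eqP.
Qed.

Lemma norm_le_enorm (R : realType) d (u : 'rV[R]_d) : `|u| <= enorm u.
Proof.
apply: rV_norm_le => [|i]; first exact: sqrtr_ge0.
rewrite -sqrtr_sqr ler_wsqrtr // /dot (bigD1 i) //= -expr2 lerDl.
by apply: sumr_ge0 => j _; rewrite -expr2 sqr_ge0.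
Qed.

Lemma enorm_le_norm (R : realType) d (u : 'rV[R]_d) : enorm u <= d.+1%:R * `|u|.
Proof.
have d0 : 0 <= d.+1%:R * `|u| by rewrite mulr_ge0.
rewrite -(ger0_norm d0) -sqrtr_sqr ler_wsqrtr // exprMn.
apply: (@le_trans _ _ (\sum_(i < d) `|u| ^+ 2)).
  apply: ler_sum => i _; rewrite -expr2 -real_normK ?num_real //.
  by rewrite lerXn2r ?nnegrE // ler_coord_norm.
rewrite sumr_const card_ord -[leLHS]mulr_natl ler_wpM2r ?sqr_ge0 //.
by rewrite -natrX ler_nat (leq_trans (leqnSn d)) // leq_pmulr.
Qed.

Lemma enorm_sqr (R : realType) d (u : 'rV[R]_d) : enorm u ^+ 2 = dot u u.
Proof. by rewrite sqr_sqrtr ?dot_ge0. Qed.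

Section Hrep.
Context (R : realType) (d m : nat) (c : 'I_m -> 'rV[R]_d) (b : 'I_m -> R).
Local Notation P := (hrep c b).

(** Small moves that respect the active constraints stay inside, with a size that
    depends on the base point only. *)
Lemma hrep_slack y : P y -> exists2 e, 0 < e & forall w,
  (forall i, dot (c i) y = b i -> dot (c i) w = 0) -> `|w| <= e -> P (y + w).
Proof.
move=> Py.
pose Q i r := forall w, (dot (c i) y = b i -> dot (c i) w = 0) ->
  r * `|w| <= 1 -> dot (c i) (y + w) <= b i.
have Qmono i r r' : r <= r' -> Q i r -> Q i r'.
  by move=> rr' Qr w w0 rw; apply: Qr => //; apply: le_trans rw; rewrite ler_wpM2r.
have exQ i : exists r, Q i r.
  have [yb|ynb] := eqVneq (dot (c i) y) (b i).
    by exists 0 => w /(_ yb) w0 _; rewrite dotDr w0 addr0.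
  have s0 : 0 < b i - dot (c i) y by rewrite subr_gt0 lt_neqAle ynb Py.
  have [C C0 cC] := dot_bounded (c i).
  exists (C / (b i - dot (c i) y)) => w _.
  rewrite mulrAC ler_pdivrMr // mul1r => Cw.
  rewrite dotDr -lerBrDl; apply: le_trans Cw; apply: le_trans (cC w).
  exact: ler_norm.
have [r r0 Qr] := finite_uniform_bound Qmono exQ.
have r1 : 0 < r + 1 by rewrite ltr_wpDl.
exists (r + 1)^-1; first by rewrite invr_gt0.
move=> w w0 we i; apply: Qr; first exact: w0.
apply: (@le_trans _ _ ((r + 1) * `|w|)); first by rewrite ler_wpM2r // lerDl.
by rewrite -ler_pdivlMl // mulr1.
Qed.

Lemma strict_interior x : (forall i, dot (c i) x < b i) -> interior P x.
Proof.
move=> sx; have [e e0 Pe] := hrep_slack (fun i => ltW (sx i)).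
apply/nbhs_ballP; exists e => // y xy; rewrite -(subrKC x y).
apply: Pe => [i xi|]; first by have := sx i; rewrite xi ltxx.
by move: xy; rewrite mx_norm_ball /ball_ /= distrC => /ltW.
Qed.

End Hrep.

Lemma interior_lt_support (R : realType) d (P : set 'rV[R]_d) u beta x :
  u != 0 -> (forall y, P y -> dot u y <= beta) -> interior P x -> dot u x < beta.
Proof.
move=> u0 uP /nbhs_ballP[e /= e0 xP].
pose t := e / (2 * `|u|).
have un : 0 < `|u| by rewrite normr_gt0.
have t0 : 0 < t by rewrite divr_gt0 // mulr_gt0.
have /uP : P (x + t *: u).
  apply: xP; rewrite mx_norm_ball /ball_ /= opprD addrA subrr sub0r normrN normrZ (gtr0_norm t0).
  rewrite (_ : t * `|u| = e / 2); last by rewrite /t; field; rewrite gt_eqF.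
  by rewrite ltr_pdivrMr // mulr_natr mulr2n ltrDl.
apply: lt_le_trans; rewrite dotDr dotZr ltrDl mulr_gt0 // lt_neqAle dot_ge0 andbT eq_sym.
by apply/eqP => /dot_eq0 /eqP; rewrite (negbTE u0).
Qed.

(** A facet lies in a supporting hyperplane, hence avoids a ball around an
    interior point.  The dimension condition excludes the improper face [P], for
    which the supporting functional is 0. *)
Lemma interior_facet_dist (R : realType) d (P : set 'rV[R]_d) x :
  interior P x -> exists2 r, 0 < r & forall F, facets P F -> r <= edist_set x F.
Proof.
move=> Px; have [e /= e0 xP] := (nbhs_ballP _ _).1 (nbhs_interior Px).
exists e => // F [[u [beta [uP FE]]] [k kd [[y0 Fy0] [V dirV dimV]]]].
have u0 : u != 0.
  apply/eqP => u0.
  have bt0 : beta = 0 by move: Fy0; rewrite FE u0 => -[_]; rewrite dotC dot0r => <-.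
  have FP : F = P.
    rewrite FE u0 bt0; apply/seteqP; split=> y /=; first by case.
    by move=> Py; split=> //; rewrite dotC dot0r.
  have Vfull : V = fullv.
    apply/eqP; rewrite eqEsubv subvf /=; apply/subvP => w _.
    have [->|w0] := eqVneq w 0; first exact: mem0v.
    have wn : 0 < `|w| by rewrite normr_gt0.
    pose t := e / (2 * `|w|).
    have t0 : 0 < t by rewrite divr_gt0 // mulr_gt0.
    have Pxw : P (x + t *: w).
      apply: interior_subset; apply: xP.
      rewrite mx_norm_ball /ball_ /= opprD addrA subrr sub0r normrN normrZ (gtr0_norm t0).
      rewrite (_ : t * `|w| = e / 2); last by rewrite /t; field; rewrite gt_eqF.
      by rewrite ltr_pdivrMr // mulr_natr mulr2n ltrDl.
    have /dirV /(_ (x + t *: w) x) := subvv V.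
    rewrite FP => /(_ Pxw (interior_subset Px)); rewrite [x + _]addrC addrK.
    by move=> /(memvZ t^-1); rewrite scalerA mulVf ?scale1r // gt_eqF.
  move: dimV; rewrite Vfull dimvf dim_matrix mul1r => dk; move: kd; rewrite dk => /eqP.
  by rewrite eqn_leq ltnn.
apply: lb_le_inf; first by exists (enorm (x - y0)); exists y0.
move=> _ [y Fy <-]; apply: le_trans (norm_le_enorm _).
rewrite leNgt; apply/negP => xy.
have : interior P y by apply: xP; rewrite mx_norm_ball.
move=> /(interior_lt_support u0 uP); move: Fy; rewrite FE => -[_ ->].
by rewrite ltxx.
Qed.

(** * Facets of an irredundant description *)

Lemma dim_dot_ker (R : realType) d (u : 'rV[R]_d) : u != 0 ->
  (\dim (lker (linfun (dot u : 'rV[R]_d -> R^o)))).+1 = d.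
Proof.
move=> u0; set f := linfun _.
have := limg_ker_dim f fullv; rewrite capfv.
have -> : \dim (f @: fullv)%VS = 1%N.
  apply/eqP; rewrite eqn_leq; apply/andP; split.
    by have := dimvS (subvf (f @: fullv)%VS); rewrite [X in (_ <= X)%N]dimvf.
  rewrite lt0n dimv_eq0; apply/eqP => f0.
  have : f u \in (f @: fullv)%VS by apply: memv_img; exact: memvf.
  rewrite f0 memv0 lfunE /= => /eqP /dot_eq0 /eqP.
  by rewrite (negbTE u0).
by rewrite addn1 dimvf dim_matrix mul1r.
Qed.

Lemma irredundant_neq0 (R : realType) d m (c : 'I_m -> 'rV[R]_d) (b : 'I_m -> R) x i :
  irredundant c b -> hrep c b x -> c i != 0.
Proof.
move=> irr Px; apply/eqP => c0; have [z + _] := irr i; have := Px i.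
by rewrite c0 ![dot 0 _]dotC !dot0r => /le_lt_trans h /h; rewrite ltxx.
Qed.

Section Facets.
Context (R : realType) (d m : nat) (c : 'I_m -> 'rV[R]_d) (b : 'I_m -> R).
Context (irr : irredundant c b).
Context (x0 : 'rV[R]_d) (sx0 : forall i, dot (c i) x0 < b i).
Local Notation P := (hrep c b).

Definition constraint_face i : set 'rV[R]_d := [set y | P y /\ dot (c i) y = b i].

(** The segment from the strictly feasible [x0] to a point violating only [i]
    crosses the hyperplane [i] at a point where all other constraints are
    strict. *)
Lemma constraint_face_relint i : exists2 y, dot (c i) y = b i & forall j, j != i -> dot (c j) y < b j.
Proof.
have [z iz jz] := irr i; have ix := sx0 i.
have dn : 0 < dot (c i) z - dot (c i) x0 by rewrite subr_gt0 (lt_trans ix).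
pose t := (b i - dot (c i) x0) / (dot (c i) z - dot (c i) x0).
have t0 : 0 < t by rewrite divr_gt0 // subr_gt0.
have t1 : t < 1 by rewrite ltr_pdivrMr // mul1r ltrD2r.
exists (x0 + t *: (z - x0)) => [|j ji]; rewrite dotDr dotZr dotBr.
  by rewrite /t divfK ?gt_eqF // subrKC.
have := jz j ji; have := sx0 j; set X := dot _ x0; set Z := dot _ z => Xb Zb.
have : t * (Z - X) <= t * (b j - X) by rewrite ler_wpM2l ?(ltW t0) // lerD2r.
have : t * (b j - X) < b j - X by rewrite gtr_pMl // subr_gt0.
lra.
Qed.

Lemma constraint_face_directions i : exists2 y, constraint_face i y &
  forall w, dot (c i) w = 0 -> exists2 e, 0 < e & constraint_face i (y + e *: w).
Proof.
have [y iy jy] := constraint_face_relint i.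
have Py : P y by move=> j; have [->|/jy/ltW//] := eqVneq j i; rewrite iy.
exists y => // w w0; have [e e0 Pe] := hrep_slack Py.
have wp : 0 < `|w| + 1 by rewrite ltr_wpDl.
exists (e / (`|w| + 1)); first by rewrite divr_gt0.
split; last by rewrite dotDr dotZr w0 mulr0 addr0.
apply: Pe => [j jb|].
  have [->|/jy] := eqVneq j i; first by rewrite dotZr w0 mulr0.
  by rewrite jb ltxx.
rewrite normrZ ger0_norm; last by rewrite divr_ge0 // ltW.
by rewrite mulrAC ler_pdivrMr // ler_wpM2l ?(ltW e0) // lerDl.
Qed.

Lemma constraint_face_facet i : facets P (constraint_face i).
Proof.
have ci : c i != 0 := irredundant_neq0 i irr (fun i => ltW (sx0 i)).
split; first by exists (c i), (b i); split=> // y; exact.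
have [y iy dy] := constraint_face_directions i.
pose V := lker (linfun (dot (c i) : 'rV[R]_d -> R^o)).
exists (\dim V); first exact: dim_dot_ker.
split; first by exists y.
exists V => // W; split=> [/subvP VW u v [_ iu] [_ iv]|FW].
  by apply: VW; rewrite memv_ker lfunE /= dotBr iu iv subrr.
apply/subvP => w; rewrite memv_ker lfunE /= => /eqP /dy[e e0 iyw].
have := FW _ _ iyw iy; rewrite [y + _]addrC addrK => /(memvZ e^-1).
by rewrite scalerA mulVf ?gt_eqF // scale1r.
Qed.

(** Any unit normal of the facet is a multiple of [c i], since the facet contains
    small moves in all directions orthogonal to [c i]. *)
Lemma constraint_face_normal i nu : unit_normal (constraint_face i) nu ->
  forall xi, `|dot (c i) xi| = enorm (c i) * `|dot nu xi|.
Proof.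
move=> [nu1 nuF] xi; have ci : c i != 0 := irredundant_neq0 i irr (fun i => ltW (sx0 i)).
have [y iy dy] := constraint_face_directions i.
have nuw w : dot (c i) w = 0 -> dot nu w = 0.
  move=> /dy[e e0 iyw]; have := nuF _ _ iyw iy.
  rewrite [y + _]addrC addrK dotZr => /eqP.
  by rewrite mulf_eq0 gt_eqF //= => /eqP.
have cc : dot (c i) (c i) != 0 by apply/eqP => /dot_eq0 /eqP; rewrite (negbTE ci).
pose t := dot (c i) nu / dot (c i) (c i).
have w0 : dot (c i) (nu - t *: c i) = 0 by rewrite dotBr dotZr divfK // subrr.
have nuE : nu = t *: c i.
  apply/eqP; rewrite -subr_eq0; apply/eqP/dot_eq0.
  rewrite dotBr dotZr [dot _ nu]dotC [dot _ (c i)]dotC w0 mulr0 subr0.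
  exact: nuw.
have : enorm nu ^+ 2 = (t * enorm (c i)) ^+ 2.
  by rewrite enorm_sqr nuE dotZr dotZl exprMn enorm_sqr expr2 mulrA.
rewrite nu1 expr1n => /esym/eqP; rewrite sqrf_eq1 => tc.
have tc1 : `|t| * enorm (c i) = 1.
  rewrite -[enorm (c i)]ger0_norm ?sqrtr_ge0 // -normrM.
  by case/orP: tc => /eqP ->; rewrite ?normrN normr1.
by rewrite nuE dotZl normrM mulrA [enorm _ * _]mulrC tc1 mul1r.
Qed.

(** Moving the weight of the vertices that are off the facet to a fixed vertex on
    it gives a point of the facet close to [x]. *)
Lemma constraint_face_edist n (a : 'I_n -> 'rV[R]_d) :
  (forall k, P (a k)) -> P `<=` in_hull a ->
  exists2 D : R, 0 <= D & forall i (p : 'rV[R]_n) x, (forall k, 0 <= p ord0 k) ->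
    p *m bary_mx a = homog 1 x ->
    edist_set x (constraint_face i) <= D * \sum_(k | dot (c i) (a k) != b i) p ord0 k.
Proof.
move=> Pa hull; pose A := \sum_(kl : 'I_n * 'I_n) `|a kl.1 - a kl.2|.
have A0 : 0 <= A by exact: sumr_ge0.
exists (d.+1%:R * A); first by rewrite mulr_ge0.
move=> i p x p0 pB.
have [y [Py yi] _] := constraint_face_directions i.
have [l li] : exists l, dot (c i) (a l) = b i.
  have [mu mu0 muB] := hull y Py.
  move: muB; rewrite mulmx_bary => /homog_inj[mu1 muy].
  have t0 k : 0 <= mu ord0 k * (b i - dot (c i) (a k)) by rewrite mulr_ge0 // subr_ge0 Pa.
  have /psumr_eq0P zero : \sum_k mu ord0 k * (b i - dot (c i) (a k)) = 0.
    under eq_bigr do rewrite mulrBr.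
    rewrite sumrB -mulr_suml mu1 mul1r -yi -muy dot_sumr.
    by apply/eqP; rewrite subr_eq0; apply/eqP; apply: eq_bigr => k _; rewrite dotZr.
  apply: contrapT => nl; move: mu1; rewrite big1 => [/eqP|k _].
    by rewrite eq_sym oner_eq0.
  have /eqP := zero (fun k _ => t0 k) k isT.
  rewrite mulf_eq0 => /orP[/eqP//|]; rewrite subr_eq0 eq_sym => /eqP kb.
  by exfalso; apply: nl; exists k.
pose a' k := if dot (c i) (a k) == b i then a k else a l.
have Pa' k : P (a' k) by rewrite /a'; case: ifP.
move: pB; rewrite mulmx_bary => /homog_inj[p1 px].
pose y' := \sum_k p ord0 k *: a' k.
have Fy' : constraint_face i y'.
  split=> [j|]; rewrite /y' dot_sumr.
    rewrite -[b j]mul1r -p1 mulr_suml; apply: ler_sum => k _.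
    by rewrite dotZr ler_wpM2l // Pa'.
  rewrite -[b i]mul1r -p1 mulr_suml; apply: eq_bigr => k _.
  by rewrite dotZr /a'; case: eqP => [->//|_]; rewrite li.
apply: (@le_trans _ _ (enorm (x - y'))).
  apply: ge_inf; last by exists y'.
  by exists 0 => _ [w _ <-]; exact: sqrtr_ge0.
apply: le_trans (enorm_le_norm _) _; rewrite -mulrA ler_wpM2l //.
rewrite -px /y' -sumrB mulr_sumr [leRHS]big_mkcond /=.
apply: (le_trans (ler_norm_sum _ _ _)); apply: ler_sum => k _.
rewrite -scalerBr normrZ ger0_norm // /a'; case: eqP => /= _.
  by rewrite subrr normr0 mulr0.
by rewrite mulrC ler_wpM2r // /A (bigD1 (k, l)) //= lerDl sumr_ge0.
Qed.

End Facets.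

(** * The derivative of the analytic centre *)

Section Estimate.
Context (R : realType) (d m n : nat) (c : 'I_m -> 'rV[R]_d) (b : 'I_m -> R).
Context (a : 'I_n -> 'rV[R]_d).
Local Notation P := (hrep c b).
Local Notation B := (bary_mx a).

Definition active_on (S : {set 'I_n}) (i : 'I_m) : bool :=
  [forall k, (k \in S) ==> (dot (c i) (a k) == b i)].

(** [facial S] is the direction of the smallest face that contains the vertices
    indexed by [S]; for empty [S] all constraints count as active. *)
Definition facial (S : {set 'I_n}) (v : 'rV[R]_d) : Prop :=
  forall i, active_on S i -> dot (c i) v = 0.

(** Let [y] be the centroid of [S] and let [mu], [nu] be weights of the points
    [y + t v] and [y - t v] of [P].  Then [(mu + nu) / 2] and the uniform weights
    [sg] on [S] represent the same point, so criticality equates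
    [sum_k (mu_k + nu_k) / (2 p_k)] with [sum_k sg_k / p_k], which is at most
    [1 / e].  This bounds every [mu_k / p_k], and [(mu - sg) / t] is the desired
    preimage of [v]. *)
Lemma facial_preimage (S : {set 'I_n}) :
  (forall k, P (a k)) -> P `<=` in_hull a ->
  exists C, S != finset.set0 -> forall v, facial S v ->
    exists2 q, q *m B = homog 0 v & forall p, critical B p ->
      forall e, 0 < e -> (forall k, k \in S -> e <= p ord0 k) ->
      forall j, `|q ord0 j| / p ord0 j <= C * `|v| / e.
Proof.
move=> Pa hull.
have [->|S0] := eqVneq S finset.set0; first by exists 0.
have s0 : 0 < (#|S|%:R : R) by rewrite ltr0n card_gt0.
pose sg : 'rV[R]_n := \row_k ((k \in S)%:R / #|S|%:R).
pose y := \sum_k sg ord0 k *: a k.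
have sg1 : \sum_k sg ord0 k = 1.
  under eq_bigr do rewrite mxE; rewrite -mulr_suml -natr_sum.
  have -> : (\sum_i (i \in S) = #|S|)%N by rewrite -sum1_card [RHS]big_mkcond.
  by rewrite divff // gt_eqF.
have sg0 k : 0 <= sg ord0 k by rewrite mxE divr_ge0.
have sgB : sg *m B = homog 1 y by rewrite mulmx_bary sg1.
have bE i : b i - dot (c i) y = \sum_k sg ord0 k * (b i - dot (c i) (a k)).
  rewrite dot_sumr -[b i]mul1r -{1}sg1 mulr_suml -sumrB; apply: eq_bigr => k _.
  by rewrite dotZr mulrBr mul1r.
have term0 i k : 0 <= sg ord0 k * (b i - dot (c i) (a k)).
  by rewrite mulr_ge0 // subr_ge0 Pa.
have Py : P y by move=> i; rewrite -subr_ge0 bE sumr_ge0.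
have act_y i : dot (c i) y = b i -> active_on S i.
  move=> yb; apply/forallP => k; apply/implyP => kS.
  have /psumr_eq0P zero : \sum_k sg ord0 k * (b i - dot (c i) (a k)) = 0.
    by rewrite -bE yb subrr.
  have /eqP := zero (fun k _ => term0 i k) k isT.
  by rewrite mulf_eq0 mxE kS mul1r invr_eq0 gt_eqF //= subr_eq0 eq_sym.
have [r r0 slack] := hrep_slack Py.
exists (3 / r) => _ v vS.
have [->|v0] := eqVneq v 0.
  exists 0 => [|p [p0 _] e e0 _ j]; first by rewrite mul0mx /homog row_mx0.
  by rewrite mxE !normr0 mul0r mulr0 mul0r.
have vn : 0 < `|v| by rewrite normr_gt0.
pose t := r / `|v|.
have t0 : 0 < t by rewrite divr_gt0.
have tv : `|t *: v| <= r by rewrite normrZ gtr0_norm // divfK ?gt_eqF.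
have [mu mu0 muB] : in_hull a (y + t *: v).
  by apply/hull/slack => // i /act_y /vS iv; rewrite dotZr iv mulr0.
have [nu nu0 nuB] : in_hull a (y + - (t *: v)).
  by apply/hull/slack => [i /act_y /vS iv|]; rewrite ?normrN // dotNr dotZr iv mulr0 oppr0.
exists (t^-1 *: (mu - sg)).
  rewrite -scalemxAl mulmxBl muB sgB homogB homogZ subrr mulr0.
  by rewrite [y + _]addrC addrK scalerA mulVf ?scale1r // gt_eqF.
move=> p [p0 cp] e e0 ep j.
have zB : (2^-1 *: (mu + nu) - sg) *m B = 0.
  rewrite mulmxBl -scalemxAl mulmxDl muB nuB sgB homogD homogZ homogB.
  rewrite (_ : 2^-1 * (1 + 1) - 1 = 0); last by field.
  rewrite (_ : 2^-1 *: _ - y = 0); first by rewrite /homog row_mx0.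
  by apply/rowP => i; rewrite !mxE; field.
have sp : \sum_k sg ord0 k / p ord0 k <= e^-1.
  rewrite -[e^-1]mul1r -sg1 mulr_suml; apply: ler_sum => k _.
  rewrite mxE; have [kS|kS] := boolP (k \in S); last by rewrite !mul0r.
  by rewrite ler_wpM2l ?divr_ge0 // lef_pV2 ?posrE // ep.
have sgj : sg ord0 j / p ord0 j <= e^-1.
  apply: le_trans sp; rewrite (bigD1 j) //= lerDl sumr_ge0 // => k _.
  by rewrite divr_ge0 // ltW.
have muj : mu ord0 j / p ord0 j <= 2 / e.
  apply: (@le_trans _ _ (2 * \sum_k sg ord0 k / p ord0 k)); last by rewrite ler_wpM2l.
  have -> : 2 * (\sum_k sg ord0 k / p ord0 k) = \sum_k (mu ord0 k + nu ord0 k) / p ord0 k.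
    apply/eqP; rewrite mulr_sumr -subr_eq0 -sumrB; apply/eqP.
    transitivity (- 2 * \sum_k (2^-1 *: (mu + nu) - sg) ord0 k / p ord0 k).
      rewrite mulr_sumr; apply: eq_bigr => k _.
      by rewrite !mxE; field; rewrite !gt_eqF.
    by rewrite (cp _ zB) mulr0.
  rewrite (bigD1 j) //= mulrDl -addrA lerDl addr_ge0 //.
    by rewrite divr_ge0 // ltW.
  by apply: sumr_ge0 => k _; rewrite divr_ge0 ?addr_ge0 // ltW.
have qE : (t^-1 *: (mu - sg)) ord0 j = t^-1 * (mu ord0 j - sg ord0 j).
  by rewrite mxE [(mu - sg) ord0 j]mxE [(- sg) ord0 j]mxE.
rewrite qE normrM gtr0_norm ?invr_gt0 //.
rewrite (_ : 3 / r * `|v| / e = t^-1 * (3 / e)); last by rewrite /t; field; rewrite !gt_eqF.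
rewrite -mulrA ler_wpM2l ?invr_ge0 ?(ltW t0) //.
have p'0 : 0 <= (p ord0 j)^-1 by rewrite invr_ge0 ltW.
apply: (@le_trans _ _ ((mu ord0 j + sg ord0 j) / p ord0 j)).
  by rewrite ler_wpM2r // (le_trans (ler_normB _ _)) // !ger0_norm //.
rewrite mulrDl (_ : 3 / e = 2 / e + e^-1); last by field; rewrite gt_eqF.
exact: lerD.
Qed.

Context (Pa : forall k, P (a k)) (hull : P `<=` in_hull a).
Context (Binj : forall u : 'rV_(d + 1), u *m B^T = 0 -> u = 0).

(** The derivative at the point [x] in the direction [v] of the critical point
    [p] over [x]; see [center_gradient]. *)
Definition bary_diff (p : 'rV[R]_n) (v : 'rV[R]_d) : 'rV[R]_n :=
  homog 0 v *m weighted_inv B (entrywise_mul p p).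

(** The product of two bounds for the same entry: the weight-free bound
    [C |v|], and [C p_k |v| / e], which compares the least squares energy with that
    of the preimage from [facial_preimage]. *)
Lemma bary_diff_facial :
  exists2 C : R, 0 <= C & forall (S : {set 'I_n}) v, S != finset.set0 -> facial S v ->
    forall p, critical B p -> forall e : R, 0 < e -> (forall k, k \in S -> e <= p ord0 k) ->
    forall k, `|bary_diff p v ord0 k| <= C * `|v| * Num.sqrt (p ord0 k / e).
Proof.
have [C1 C10 orthC] := weighted_orth_bound B.
pose Q S C := S != finset.set0 -> forall v, facial S v ->
    exists2 q, q *m B = homog 0 v & forall p, critical B p ->
      forall e : R, 0 < e -> (forall k, k \in S -> e <= p ord0 k) ->
      forall j, `|q ord0 j| / p ord0 j <= C * `|v| / e.
have Qmono S C C' : C <= C' -> Q S C -> Q S C'.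
  move=> CC' QC S0 v vS; have [q qB qp] := QC S0 v vS; exists q => // p cp e e0 ep j.
  apply: le_trans (qp p cp e e0 ep j) _.
  by rewrite ler_wpM2r ?invr_ge0 ?(ltW e0) // ler_wpM2r.
have [C2 C20 QC2] := finite_uniform_bound Qmono (fun S => facial_preimage S Pa hull).
have nC2 : 0 <= n%:R * C2 by rewrite mulr_ge0.
exists (C1 + n%:R * C2); first by rewrite addr_ge0.
move=> S v S0 vS p cp e e0 ep k.
have [q' q'B q'p] := QC2 S S0 v vS.
have [p0 _] := cp.
have pp := positive_row_entrywise_mul p0 p0.
set q := bary_diff p v.
have oq : weighted_orth B (entrywise_mul p p) q by exact: weighted_inv_orth.
have qB : q *m B = homog 0 v by exact: weighted_invK.
have bound1 : `|q ord0 k| <= C1 * `|v|.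
  apply: le_trans (ler_coord_norm _ _) _; apply: le_trans (orthC _ _ pp oq) _.
  by rewrite ler_wpM2l // qB norm_homog0.
have D0 : 0 <= C2 * `|v| / e by rewrite mulr_ge0 ?invr_ge0 ?(ltW e0) // mulr_ge0.
have bound2 : `|q ord0 k| / p ord0 k <= n%:R * (C2 * `|v| / e).
  have nD0 : 0 <= n%:R * (C2 * `|v| / e) by rewrite mulr_ge0.
  rewrite -(@ler_pXn2r _ 2) ?nnegrE ?divr_ge0 ?(ltW (p0 k)) //.
  apply: (@le_trans _ _ (\sum_j q ord0 j ^+ 2 / entrywise_mul p p ord0 j)).
    rewrite (bigD1 k) //= expr_div_n real_normK ?num_real // [entrywise_mul p p ord0 k]mxE -expr2 lerDl.
    by apply: sumr_ge0 => j _; rewrite divr_ge0 ?sqr_ge0 // ltW.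
  apply: le_trans (weighted_orth_energy pp oq (etrans q'B (esym qB))) _.
  apply: (@le_trans _ _ (\sum_(j < n) (C2 * `|v| / e) ^+ 2)).
    apply: ler_sum => j _; rewrite [entrywise_mul p p ord0 j]mxE -expr2 -[q' _ _ ^+ 2]real_normK ?num_real //.
    rewrite -expr_div_n ler_pXn2r ?nnegrE //; first exact: q'p.
    by rewrite divr_ge0 // ltW.
  rewrite sumr_const card_ord -[leLHS]mulr_natl [leRHS]exprMn ler_wpM2r ?sqr_ge0 //.
  by rewrite -natrX ler_nat; case: (n) => // n'; rewrite expnS expn1 leq_pmulr.
rewrite ler_pdivrMr // in bound2.
have pe : 0 <= p ord0 k / e by rewrite divr_ge0 // ltW.
have CV : 0 <= (C1 + n%:R * C2) * `|v| by rewrite mulr_ge0 // addr_ge0.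
rewrite -(@ler_pXn2r _ 2) ?nnegrE //; last by rewrite mulr_ge0 ?sqrtr_ge0.
rewrite exprMn sqr_sqrtr // expr2.
apply: (@le_trans _ _ ((C1 * `|v|) * (n%:R * (C2 * `|v| / e) * p ord0 k))).
  exact: ler_pM.
rewrite (_ : _ * _ = (C1 * `|v|) * (n%:R * C2 * `|v|) * (p ord0 k / e)); last by ring.
rewrite ler_wpM2r // expr2 ler_pM ?mulr_ge0 //.
  by rewrite ler_wpM2r // lerDl.
by rewrite ler_wpM2r // lerDr.
Qed.

(** Correcting [xi] by a bounded pseudo-inverse of the active normals makes it
    orthogonal to all of them. *)
Lemma facial_projection :
  exists2 C : R, 0 <= C & forall S xi, exists2 w, facial S w &
    forall h : R, 0 <= h -> (forall i, active_on S i -> `|dot (c i) xi| <= h) ->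
      `|xi - w| <= C * h.
Proof.
pose G S : 'M[R]_(d, m) := \matrix_(j, i) (if active_on S i then c i ord0 j else 0).
have GE S u i : (u *m G S) ord0 i = if active_on S i then dot (c i) u else 0.
  rewrite mxE; case: ifP => ai.
    by apply: eq_bigr => j _; rewrite mxE ai mulrC.
  by rewrite big1 // => j _; rewrite mxE ai mulr0.
pose Q S C := forall u : 'rV_m, `|u *m pinvmx (G S)| <= C * `|u|.
have Qmono S C C' : C <= C' -> Q S C -> Q S C'.
  by move=> CC' QC u; apply: le_trans (QC u) _; rewrite ler_wpM2r.
have exQ S : exists C, Q S C by have [C _ QC] := mulmx_bounded (pinvmx (G S)); exists C.
have [C C0 QC] := finite_uniform_bound Qmono exQ.
exists C => // S xi; pose z := xi *m G S *m pinvmx (G S).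
exists (xi - z) => [i ai|h h0 xih].
  have /rowP/(_ i) : z *m G S = xi *m G S by rewrite mulmxKpV // submxMl.
  by rewrite !GE ai dotBr => ->; rewrite subrr.
rewrite opprB addrC subrK; apply: le_trans (QC S _) _; rewrite ler_wpM2l //.
by apply: rV_norm_le => // i; rewrite GE; case: ifP => [/xih//|_]; rewrite normr0.
Qed.

(** With [w S] the facial part of [xi] for [S], the vector [w S] goes from 0 for
    empty [S], because [P] is bounded, to [xi] for the set of all vertices.  Adding
    the vertices in the order of decreasing [p], the increment at [j] has norm at
    most a multiple of [M sqrt p_j], and [bary_diff_facial] with [e = p_j] turns it
    into a multiple of [M sqrt p_k]. *)
Lemma bary_diff_bound : bounded_set P ->
  (exists x, P x) ->
  exists2 C : R, 0 <= C & forall p, critical B p -> forall (M : R) xi, 0 <= M ->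
    (forall i, `|dot (c i) xi| <=
       M * Num.sqrt (\sum_(k | dot (c i) (a k) != b i) p ord0 k)) ->
    forall k, `|bary_diff p xi ord0 k| <= C * M * Num.sqrt (p ord0 k).
Proof.
move=> bP [x Px].
have [C1 C10 fac] := bary_diff_facial.
have [C2 C20 proj] := facial_projection.
exists (n%:R * (C1 * (2 * C2 * n%:R))); first by rewrite !mulr_ge0.
move=> p cp M xi M0 cxi; have [p0 _] := cp.
have /choice[w wP] : forall S, exists w, facial S w /\ 
    forall h : R, 0 <= h -> (forall i, active_on S i -> `|dot (c i) xi| <= h) ->
      `|xi - w| <= C2 * h.
  by move=> S; have [w wS wxi] := proj S xi; exists w.
pose tail (S : {set 'I_n}) := Num.sqrt (\sum_(k | k \notin S) p ord0 k).
have xiw S : `|xi - w S| <= C2 * (M * tail S).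
  have [_] := wP S; apply; first by rewrite mulr_ge0 ?sqrtr_ge0.
  move=> i /forallP iS; apply: le_trans (cxi i) _; rewrite ler_wpM2l // ler_wsqrtr //.
  rewrite [leRHS]big_mkcond [leLHS]big_mkcond /=; apply: ler_sum => k _.
  have := iS k; case: (k \in S) => /= [->//|_].
  by case: ifP => // _; exact: ltW.
have w_all : w [set: 'I_n]%SET = xi.
  apply/esym/eqP; rewrite -subr_eq0 -normr_eq0 eq_le normr_ge0 andbT.
  apply: le_trans (xiw _) _; rewrite /tail big1 => [|k]; last by rewrite inE.
  by rewrite sqrtr0 !mulr0.
have w_none : w finset.set0 = 0.
  apply/eqP; apply: contraT => w0; have [j jw] := bounded_recession bP Px w0.
  have [/(_ j)] := wP finset.set0.
  have aj : active_on finset.set0 j by apply/forallP => k; rewrite inE.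
  by move=> /(_ aj) wj _; move: jw; rewrite wj ltxx.
set K := C1 * (2 * C2 * n%:R).
(* [S] ranges over the sets of vertices of largest weight. *)
have step (S : {set 'I_n}) : (forall j k, j \in S -> k \notin S -> p ord0 k <= p ord0 j) ->
    forall k, `|bary_diff p (w S) ord0 k| <= #|S|%:R * K * M * Num.sqrt (p ord0 k).
  have [s] := ubnP #|S|; elim: s S => // s IH S; rewrite ltnS => Ss up k.
  have [S0|/set0Pn[j0 j0S]] := eqVneq S finset.set0.
    by rewrite S0 w_none /bary_diff /homog row_mx0 mul0mx mxE normr0 cards0 !mul0r.
  have [j jS minj] := @arg_minP _ _ _ j0 (fun k => k \in S) (fun k => p ord0 k) j0S.
  pose S' := (S :\ j)%SET.
  have cardS : #|S| = #|S'|.+1 by rewrite (cardsD1 j) jS.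
  have up' i l : i \in S' -> l \notin S' -> p ord0 l <= p ord0 i.
    rewrite !inE => /andP[ij iS]; rewrite negb_and negbK => /orP[/eqP->|lS].
      exact: minj.
    exact: up.
  have S'sub i : active_on S i -> active_on S' i.
    move=> /forallP iS; apply/forallP => l; apply/implyP; rewrite !inE => /andP[_ lS].
    by have := iS l; rewrite lS.
  have vS : facial S (w S - w S').
    move=> i iS; have [fS _] := wP S; have [fS' _] := wP S'.
    by rewrite dotBr (fS _ iS) (fS' _ (S'sub _ iS)) subrr.
  have vle : `|w S - w S'| <= 2 * C2 * n%:R * M * Num.sqrt (p ord0 j).
    have tailS' : tail S' <= n%:R * Num.sqrt (p ord0 j).
      rewrite -[n%:R]ger0_norm // -sqrtr_sqr -sqrtrM ?sqr_ge0 // ler_wsqrtr //.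
      apply: (@le_trans _ _ (\sum_(l < n) p ord0 j)).
        rewrite big_mkcond /=; apply: ler_sum => l _; case: ifP => lS'; last exact: ltW.
        have [lS|lS] := boolP (l \in S); last exact: up.
        suff -> : l = j by [].
        by apply/eqP; move: lS'; rewrite !inE lS andbT negbK.
      rewrite sumr_const card_ord -[leLHS]mulr_natl ler_wpM2r ?(ltW (p0 j)) //.
      by rewrite -natrX ler_nat; case: (n) => // n'; rewrite expnS expn1 leq_pmulr.
    have tailS : tail S <= tail S'.
      rewrite ler_wsqrtr // [leRHS]big_mkcond [leLHS]big_mkcond /=; apply: ler_sum => l _.
      rewrite !inE negb_and; case: (l \in S); rewrite /= ?orbT ?orbF //.
      by case: ifP => // _; exact: ltW.
    rewrite (_ : w S - w S' = (xi - w S') - (xi - w S)); last first.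
      by apply/rowP => i; rewrite !mxE; ring.
    apply: le_trans (ler_normB _ _) _.
    apply: le_trans (lerD (xiw _) (xiw _)) _.
    have MC : 0 <= C2 * M by rewrite mulr_ge0.
    have := ler_wpM2l MC tailS'; have := ler_wpM2l MC (le_trans tailS tailS').
    lra.
  have -> : bary_diff p (w S) = bary_diff p (w S') + bary_diff p (w S - w S').
    by rewrite -mulmxDl homogD addr0 subrKC.
  rewrite mxE; apply: le_trans (ler_normD _ _) _.
  have S's : (#|S'| < s)%N by rewrite -cardS.
  have IHS := IH S' S's up' k.
  have jS' l : l \in S -> p ord0 j <= p ord0 l by exact: minj.
  have S0 : S != finset.set0 by apply/set0Pn; exists j.
  have stepv := fac S _ S0 vS p cp _ (p0 j) jS' k.
  have pj : 0 < Num.sqrt (p ord0 j) by rewrite sqrtr_gt0.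
  have : C1 * `|w S - w S'| * Num.sqrt (p ord0 k / p ord0 j) <=
      K * M * Num.sqrt (p ord0 k).
    rewrite sqrtrM ?(ltW (p0 k)) // sqrtrV ?(ltW (p0 j)) //.
    rewrite mulrA ler_pdivrMr // [leRHS]mulrAC ler_wpM2r ?sqrtr_ge0 //.
    by rewrite /K -!mulrA ler_wpM2l // !mulrA.
  rewrite cardS -natr1 !mulrDl mul1r => le2.
  by apply: lerD => //; apply: le_trans stepv le2.
move=> k; have := step [set: 'I_n]%SET; rewrite w_all => /(_ _ k).
rewrite cardsT card_ord; apply=> j l _; by rewrite inE.
Qed.

End Estimate.

(** * The analytic centre as a function of the point *)

Lemma mul_homog0 (R : realType) d k (v : 'rV[R]_d) (W : 'M[R]_(d + 1, k)) :
  homog 0 v *m W = v *m usubmx W.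
Proof.
rewrite -{1}[W]vsubmxK /homog mul_row_col (_ : const_mx 0 = 0) ?mul0mx ?addr0 //.
Qed.

(** A small step beyond [x], away from the centroid, stays in [P]; averaging its
    weights with those of the centroid gives positive weights of [x]. *)
Lemma critical_exists_interior (R : realType) d n (a : 'I_n -> 'rV[R]_d) (P : set 'rV[R]_d) :
  (0 < n)%N -> (P `<=` in_hull a) ->
  forall x, interior P x ->
  exists2 p, critical (bary_mx a) p & p *m bary_mx a = homog 1 x.
Proof.
move=> n0 hull x Px; apply: critical_exists.
  exists 1 => p p0; rewrite mulmx_bary => /homog_inj[p1 _].
  apply: rV_norm_le => // k; rewrite ger0_norm // -p1 (bigD1 k) //= lerDl.
  exact: sumr_ge0.
have nn : n%:R != 0 :> R by rewrite pnatr_eq0 -lt0n.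
pose sg : 'rV[R]_n := const_mx n%:R^-1.
pose x0 := \sum_k sg ord0 k *: a k.
have sgB : sg *m bary_mx a = homog 1 x0.
  rewrite mulmx_bary; congr homog; under eq_bigr do rewrite mxE.
  by rewrite sumr_const card_ord -[LHS]mulr_natl divff.
have [e /= e0 xP] := (nbhs_ballP _ _).1 Px.
have den : 0 < `|x - x0| + 1 by rewrite ltr_wpDl.
pose t := e / (2 * (`|x - x0| + 1)).
have t0 : 0 < t by rewrite divr_gt0 // mulr_gt0.
have [mu mu0 muB] : in_hull a (x + t *: (x - x0)).
  apply: hull; apply: xP.
  rewrite mx_norm_ball /ball_ /= opprD addrA subrr sub0r normrN normrZ (gtr0_norm t0).
  rewrite /t mulrAC ltr_pdivrMr ?mulr_gt0 // ltr_pM2l //.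
  by have := normr_ge0 (x - x0); lra.
have t1 : 0 < 1 + t by rewrite addr_gt0.
exists ((1 + t)^-1 *: (mu + t *: sg)) => [k|].
  rewrite !mxE mulr_gt0 ?invr_gt0 // ltr_wpDl // mulr_gt0 // invr_gt0.
  by rewrite ltr0n.
rewrite -scalemxAl mulmxDl muB -scalemxAl sgB homogZ homogD homogZ mulr1 mulVf ?gt_eqF //.
by congr homog; apply/rowP => j; rewrite !mxE; field; rewrite gt_eqF.
Qed.

Section Center.
Context (R : realType) (d n : nat) (a : 'I_n -> 'rV[R]_d) (U : set 'rV[R]_d).
Local Notation B := (bary_mx a).
Context (w : 'rV[R]_d -> 'rV[R]_n) (openU : open U).
Context (wcrit : forall x, U x -> critical B (w x)).
Context (wB : forall x, U x -> w x *m B = homog 1 x).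

Lemma center_lipschitz : exists2 C : R, 0 <= C & forall k x y, U x -> U y ->
  `|w x ord0 k - w y ord0 k| <= C * `|x - y|.
Proof.
have [C C0 orthC] := weighted_orth_bound B.
exists C => // k x y Ux Uy.
have [wx _] := wcrit Ux; have [wy _] := wcrit Uy.
have := orthC _ _ (positive_row_entrywise_mul wy wx) (critical_diff_orth (wcrit Uy) (wcrit Ux)).
rewrite mulmxBl !wB // homogB subrr => wxy.
apply: (@le_trans _ _ `|w x - w y|).
  by have := ler_coord_norm (w x - w y) k; rewrite !mxE.
by apply: le_trans wxy _; rewrite ler_wpM2l // norm_homog0.
Qed.

Context (Binj : forall u : 'rV_(d + 1), u *m B^T = 0 -> u = 0).
Context (p : 'I_n -> 'rV[R]_d -> R) (C : R).
Context (pw : forall k x, U x -> p k x = w x ord0 k).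
Context (plip : forall k x y, `|p k x - p k y| <= C * `|x - y|).

Lemma center_coord_continuous k : continuous (p k).
Proof.
move=> x; apply/(@cvgrPdist_le _ _ _ (nbhs x) (nbhs_filter x)) => e e0.
have C1 : 0 < `|C| + 1 by rewrite ltr_wpDl.
near=> y; apply: le_trans (plip _ _ _) _.
apply: (@le_trans _ _ ((`|C| + 1) * `|x - y|)).
  by rewrite ler_wpM2r //; have := ler_norm C; lra.
rewrite -ler_pdivlMl //; near: y.
have /cvgrPdist_le qq : (y @[y --> x]) --> x by exact: cvg_id.
by apply: qq; rewrite mulr_gt0 // invr_gt0.
Unshelve. all: by end_near. Qed.

(** The increment [w y - w x] is exactly [y - x] times a weighted inverse whose
    entries are rational in [w y], hence continuous at [x]. *)
Lemma center_differentiable k x : U x -> differentiable (p k) x /\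
  forall i, partial i (p k) x = bary_diff a (w x) (delta_mx ord0 i) ord0 k.
Proof.
move=> Ux; have [wx _] := wcrit Ux.
pose G y : 'rV[R]_d :=
  \row_i (homog 0 (delta_mx ord0 i) *m weighted_inv B (entrywise_mul (w x) (w y))) ord0 k.
have [||dpk ppk] := @differentiable_of_slope R d (p k) x G.
- apply: filterS (open_nbhs_nbhs (conj openU Ux)) => y Uy.
  have [wy _] := wcrit Uy.
  have -> : dot (G y) (y - x) =
      (homog 0 (y - x) *m weighted_inv B (entrywise_mul (w x) (w y))) ord0 k.
    rewrite mul_homog0 mxE /dot; apply: eq_bigr => i _.
    by rewrite [G y ord0 i]mxE mul_homog0 -rowE [row _ _ _ _]mxE mulrC.
  rewrite !pw //; have pos := positive_row_entrywise_mul wx wy.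
  have <- : w y - w x = homog 0 (y - x) *m weighted_inv B (entrywise_mul (w x) (w y)).
    apply: (weighted_orth_uniq pos).
    + exact: critical_diff_orth (wcrit Ux) (wcrit Uy).
    + exact: weighted_inv_orth.
    + by rewrite weighted_invK // mulmxBl !wB // homogB subrr.
  by rewrite !mxE.
- move=> i; apply: (@rational_continuous R d n U p openU) => //.
    by move=> j; exact: center_coord_continuous.
  apply: (RatExt (@rational_weighted_inv R d n U p _ B (fun y => entrywise_mul (w x) (w y))
    (homog 0 (delta_mx ord0 i)) Binj _ _ k)).
  + by move=> y Uy; have [wy _] := wcrit Uy; exact: positive_row_entrywise_mul.
  + move=> j; apply: (RatExt (RatMul (RatCst U p (w x ord0 j)) (RatGen U p j))).
    by move=> y Uy; rewrite mxE pw.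
  + by move=> y _; rewrite [RHS]mxE.
- by split=> // i; rewrite ppk mxE.
Qed.

Lemma center_smooth k : smooth_on U (p k).
Proof.
apply: (@rational_smooth R d n U p openU) (RatGen U p k).
  by move=> j x Ux; have [] := center_differentiable j Ux.
move=> j i.
apply: (RatExt (@rational_weighted_inv R d n U p _ B (fun y => entrywise_mul (w y) (w y))
    (homog 0 (delta_mx ord0 i)) Binj _ _ j)).
- by move=> y Uy; have [wy _] := wcrit Uy; exact: positive_row_entrywise_mul.
- move=> l; apply: (RatExt (RatMul (RatGen U p l) (RatGen U p l))).
  by move=> y Uy; rewrite mxE pw.
- by move=> x Ux; have [_ ->] := center_differentiable j Ux.
Qed.

Lemma center_gradient k x xi : U x ->
  dot xi (gradient (p k) x) = bary_diff a (w x) xi ord0 k.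
Proof.
move=> Ux; have [_ pk] := center_differentiable k Ux.
rewrite /bary_diff mul_homog0 mxE /dot; apply: eq_bigr => i _.
by rewrite mxE pk /bary_diff mul_homog0 -rowE [row _ _ _ _]mxE.
Qed.

End Center.

(** * The theorem *)

Lemma le0_of_small (R : realType) (z K : R) :
  (forall t, 0 < t -> t <= 1 -> z <= K * t) -> z <= 0.
Proof.
move=> zK; rewrite leNgt; apply/negP => z0.
have K1 : 0 < `|K| + 1 by rewrite ltr_wpDl.
pose s := `|K| + 1 + z.
have s0 : 0 < s by rewrite addr_gt0.
have t0 : 0 < z / s by rewrite divr_gt0.
have t1 : z / s <= 1 by rewrite ler_pdivrMr // mul1r /s lerDr ltW.
have := zK _ t0 t1; apply/negP; rewrite -ltNge mulrA ltr_pdivrMr // mulrC.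
by rewrite ltr_pM2l // /s; have := ler_norm K; lra.
Qed.

(** Positivity and the barycentric identities pass to a point that is the limit of
    a segment in [U], since the defect is at most a multiple of the distance. *)
Lemma barycentric_at_boundary (R : realType) d n (a : 'I_n -> 'rV[R]_d) (U : set 'rV[R]_d)
    (p : 'I_n -> 'rV[R]_d -> R) (C : R) (x x0 : 'rV[R]_d) :
  0 <= C ->
  (forall k y z, `|p k y - p k z| <= C * `|y - z|) ->
  (forall t, 0 < t -> t <= 1 -> U (x + t *: (x0 - x))) ->
  (forall y, U y -> forall k, 0 <= p k y) ->
  (forall y, U y -> (\row_k p k y) *m bary_mx a = homog 1 y) ->
  (forall k, 0 <= p k x) /\ (\row_k p k x) *m bary_mx a = homog 1 x.
Proof.
move=> C0 plip xU p0 pB.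
have dx t : 0 < t -> `|x - (x + t *: (x0 - x))| = t * `|x0 - x|.
  by move=> t0; rewrite opprD addrA subrr sub0r normrN normrZ gtr0_norm.
split=> [k|].
  rewrite -oppr_le0; apply: (@le0_of_small _ _ (C * `|x0 - x|)) => t t0 t1.
  have := plip k x (x + t *: (x0 - x)); rewrite dx // ler_norml => /andP[+ _].
  have := p0 _ (xU t t0 t1) k.
  by rewrite -mulrA [`|_| * t]mulrC; lra.
have [C' C'0 BC] := mulmx_bounded (bary_mx a).
apply/eqP; rewrite -subr_eq0 -normr_eq0 eq_le normr_ge0 andbT.
apply: (@le0_of_small _ _ ((C' * C + 1) * `|x0 - x|)) => t t0 t1.
have yB := pB _ (xU t t0 t1); set y := x + t *: (x0 - x) in yB *.
have xy : `|x - y| = t * `|x0 - x| by exact: dx.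
rewrite -[_ - homog 1 x](subrKA (homog 1 y)) -{1}yB -mulmxBl homogB subrr.
apply: (le_trans (ler_normD _ _)).
rewrite (_ : (C' * C + 1) * `|x0 - x| * t = C' * (C * `|x - y|) + `|x - y|); last first.
  by rewrite xy; ring.
apply: lerD; last by rewrite distrC; exact: norm_homog0.
apply: (le_trans (BC _)); rewrite ler_wpM2l //.
apply: rV_norm_le => [|k]; first by rewrite mulr_ge0.
by rewrite !mxE.
Qed.

Theorem theorem2p2 (R : realType) (d n : nat) (hn : (2 <= n)%N)
    (P : set 'rV[R]_d) (a : 'I_n -> 'rV[R]_d)
    (hP : polyhedron P) (hPb : bounded_set P)
    (ha : injective a) (hav : range a = vertices P)
    (ha1 : a (Ordinal (ltnW hn)) = 0)
    (hspan : <<[seq a i | i : 'I_n <- enum 'I_n & (0 < i)%N]>>%VS = fullv) :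
  exists p : 'I_n -> 'rV[R]_d -> R,
    (forall k, [/\ [lipschitz p k x | x in P],
                   (forall x, P x -> 0 <= p k x) &
                   smooth_on (interior P) (p k)]) /\
    [/\ (forall k x, interior P x -> 0 < p k x),
        (forall x, P x ->
           \sum_(k < n) p k x = 1 /\ x = \sum_(k < n) p k x *: a k) &
        exists N : R,
          forall nu : set 'rV[R]_d -> 'rV[R]_d,
            (forall G, facets P G -> unit_normal G (nu G)) ->
          forall (k : 'I_n) (xi x : 'rV[R]_d), interior P x ->
            `|dot xi (gradient (p k) x)| / Num.sqrt (p k x) <=
            N * max_facets P
                  (fun G => `|dot (nu G) xi| / Num.sqrt (edist_set x G))].
Proof.
have [m [c [b [PE irr]]]] := irredundant_hrep hP.
have n0 : (0 < n)%N by exact: ltnW.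
have Pa k : P (a k).
  have : vertices P (a k) by rewrite -hav; exists k.
  by move=> [u [beta [_ /seteqP[/(_ (a k) erefl)[]]]]].
have hull : P `<=` in_hull a.
  by rewrite PE; apply: hrep_hull; rewrite -PE // -hav.
have spanning v : (forall k, dot v (a k) = 0) -> v = 0.
  move=> va; apply: (span_dot_eq0 hspan) => u /mapP[k _ ->]; exact: va.
have Binj (u : 'rV_(d + 1)) : u *m (bary_mx a)^T = 0 -> u = 0.
  rewrite -[u]hsubmxK /bary_mx tr_row_mx mul_row_col => u0.
  have uk k : dot (lsubmx u) (a k) + rsubmx u ord0 ord0 = 0.
    move/rowP: u0 => /(_ k); rewrite !mxE big_ord1 !mxE mulr1 => <-.
    by congr (_ + _); apply: eq_bigr => j _; rewrite !mxE.
  have r0 : rsubmx u ord0 ord0 = 0 by have := uk (Ordinal (ltnW hn)); rewrite ha1 dot0r add0r.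
  rewrite [lsubmx u]spanning ?row_mx0 => [|k]; last by rewrite -[RHS](uk k) r0 addr0.
  rewrite (_ : rsubmx u = 0) ?row_mx0 //; apply/rowP => j.
  by rewrite ord1 r0 mxE.
(* The centroid of the vertices: a constraint active there is active at all
   vertices, in particular at 0, so its normal is orthogonal to their span. *)
have [x0 sx0] : exists x0, forall i, dot (c i) x0 < b i.
  exists (\sum_k n%:R^-1 *: a k) => i.
  have nn : n%:R != 0 :> R by rewrite pnatr_eq0 -lt0n.
  have slack k : 0 <= b i - dot (c i) (a k).
    by rewrite subr_ge0; have := Pa k; rewrite PE; apply.
  have -> : b i = \sum_(k < n) n%:R^-1 * b i.
    by rewrite sumr_const card_ord -[RHS]mulr_natl mulrA divff // mul1r.
  have t0 k : 0 <= n%:R^-1 * b i - dot (c i) (n%:R^-1 *: a k).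
    by rewrite dotZr -mulrBr mulr_ge0 // invr_ge0.
  rewrite dot_sumr -subr_gt0 -sumrB lt_neqAle sumr_ge0 // andbT.
  apply/negP => /eqP/esym/psumr_eq0P zero.
  have {}zero k : dot (c i) (a k) = b i.
    have /eqP := zero (fun k _ => t0 k) k isT.
    by rewrite dotZr -mulrBr mulf_eq0 invr_eq0 (negbTE nn) subr_eq0 eq_sym => /eqP.
  have b0 : b i = 0 by rewrite -(zero (Ordinal (ltnW hn))) ha1 dot0r.
  have P0 : hrep c b 0 by rewrite -PE -ha1; exact: Pa.
  have /eqP := irredundant_neq0 i irr P0; apply; apply: spanning => k.
  by rewrite zero b0.
have xint : interior P x0 by rewrite PE; exact: strict_interior.
have xseg x t : P x -> 0 < t -> t <= 1 -> interior P (x + t *: (x0 - x)).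
  rewrite PE => Px t0 t1; apply: strict_interior => i.
  rewrite dotDr dotZr dotBr; have := Px i; have := sx0 i.
  set u := dot _ x; set v := dot _ x0 => vb ub.
  have : t * v < t * b i by rewrite ltr_pM2l.
  have : (1 - t) * u <= (1 - t) * b i by rewrite ler_wpM2l // subr_ge0.
  lra.
have /choice[w wP] : forall x, exists p, interior P x ->
    critical (bary_mx a) p /\ p *m bary_mx a = homog 1 x.
  move=> x; have [Px|nPx] := pselect (interior P x); last by exists 0.
  by have [p pc pB] := critical_exists_interior n0 hull Px; exists p.
have wcrit x Px := (wP x Px).1.
have wB x Px := (wP x Px).2.
have [C C0 wlip] := center_lipschitz wcrit wB.
have /choice[p pP] : forall k, exists f : 'rV[R]_d -> R,
    (forall x, interior P x -> f x = w x ord0 k) /\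
    forall x y, `|f x - f y| <= C * `|x - y|.
  move=> k; have [f fw flip] := lipschitz_extension (ex_intro _ x0 xint) C0 (wlip k).
  by exists f.
have pw k x Px := (pP k).1 x Px.
have plip k := (pP k).2.
have pos k x : interior P x -> 0 < p k x.
  by move=> Px; rewrite pw //; have [w0 _] := wcrit x Px; exact: w0.
have rowp x : interior P x -> \row_k p k x = w x.
  by move=> Px; apply/rowP => k; rewrite mxE pw.
have pbary x : P x -> (forall k, 0 <= p k x) /\ (\row_k p k x) *m bary_mx a = homog 1 x.
  move=> Px; apply: (@barycentric_at_boundary R d n a (interior P) p C x x0 C0 plip).
  - by move=> t t0 t1; exact: xseg.
  - by move=> y Py k; exact/ltW/pos.
  - by move=> y Py; rewrite rowp // wB.
have openI : open (interior P) by exact: open_interior.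
exists p; split=> [k|].
  split.
  - have Px0 : (P `*` P) (x0, x0) by split; exact: interior_subset.
    apply: (@klipschitzW _ _ _ C _ _ (globally_properfilter Px0)) => -[y z] _.
    exact: plip.
  - by move=> x Px; have [] := pbary x Px.
  - exact: (center_smooth openI wcrit wB Binj pw plip).
split=> //.
  move=> x Px; have [_] := pbary x Px; rewrite mulmx_bary => /homog_inj[p1 px].
  split; first by rewrite -p1; apply: eq_bigr => k _; rewrite mxE.
  by rewrite -{1}px; apply: eq_bigr => k _; rewrite mxE.
have Pa' k : hrep c b (a k) by rewrite -PE; exact: Pa.
have hull' : hrep c b `<=` in_hull a by rewrite -PE.
have bP' : bounded_set (hrep c b) by rewrite -PE.
have [K K0 main] := bary_diff_bound Pa' hull' Binj bP' (ex_intro _ _ (fun i => ltW (sx0 i))).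
have [D D0 dist] := constraint_face_edist irr sx0 Pa' hull'.
pose E := \sum_i enorm (c i).
have E0 : 0 <= E by apply: sumr_ge0 => i _; exact: sqrtr_ge0.
(* [K] bounds the derivative, [E] the norms of the [c i], and [D] compares the
   distance to a facet with the total weight off that facet. *)
exists (K * (E * Num.sqrt D)) => nu nuN k xi x Px.
rewrite (center_gradient openI wcrit wB Binj pw plip) // pw //.
set M := max_facets _ _.
have [wx0 _] := wcrit x Px.
have [r r0 distr] := interior_facet_dist Px.
have [Cx Cx0 xiC] := dot_bounded xi.
pose g G := `|dot (nu G) xi| / Num.sqrt (edist_set x G).
have gM G : facets P G -> g G <= M.
  move=> FG; apply: ub_le_sup; last by exists G.
  exists (Cx / Num.sqrt r) => _ [F FF <-].
  have [nu1 _] := nuN F FF.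
  apply: ler_pM; rewrite ?invr_ge0 ?sqrtr_ge0 //.
    rewrite dotC; apply: le_trans (xiC _) _; rewrite -[leRHS]mulr1 ler_wpM2l //.
    by rewrite -nu1; exact: norm_le_enorm.
  rewrite lef_pV2 ?posrE ?sqrtr_gt0 //; last exact: lt_le_trans (distr F FF).
  by rewrite ler_wsqrtr // distr.
have g0 G : 0 <= g G by rewrite divr_ge0 // sqrtr_ge0.
have M0 : 0 <= M.
  have [[G FG]|nF] := pselect (exists G, facets P G); first exact: le_trans (gM G FG).
  rewrite /M /max_facets (_ : [set _ | _ in _] = set0) ?sup0 //.
  by apply/seteqP; split=> // t [G FG _]; exfalso; apply: nF; exists G.
rewrite ler_pdivrMr ?sqrtr_gt0 //.
apply: (@le_trans _ _ (K * (E * Num.sqrt D * M) * Num.sqrt (w x ord0 k))); last first.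
  by rewrite !mulrA.
apply: main => [||i]; first exact: wcrit.
  by rewrite !mulr_ge0 ?sqrtr_ge0.
have FG : facets P (constraint_face c b i) by rewrite PE; exact: (constraint_face_facet irr sx0 i).
have ed0 : 0 < edist_set x (constraint_face c b i) by exact: lt_le_trans (distr _ FG).
rewrite (constraint_face_normal irr sx0 (nuN _ FG)).
have -> : `|dot (nu (constraint_face c b i)) xi| =
    g (constraint_face c b i) * Num.sqrt (edist_set x (constraint_face c b i)).
  by rewrite /g divfK // gt_eqF // sqrtr_gt0.
set sm := \sum_(_ | _) _.
have sm0 : 0 <= sm by apply: sumr_ge0 => j _; exact: ltW.
have -> : E * Num.sqrt D * M * Num.sqrt sm = E * (M * Num.sqrt (D * sm)).
  by rewrite sqrtrM //; ring.
apply: ler_pM; rewrite ?sqrtr_ge0 ?mulr_ge0 ?sqrtr_ge0 //.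
  by rewrite /E (bigD1 i) //= lerDl; apply: sumr_ge0 => j _; exact: sqrtr_ge0.
apply: ler_pM; rewrite ?sqrtr_ge0 //; first exact: gM.
rewrite ler_wsqrtr //; apply: dist => [j|]; first exact: ltW.
exact: wB.
Qed.
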